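(* Let $K$ be a compact Hausdorff space. Suppose that $(f_n)$ is a normalized weakly null sequence in $C(K)$ such that there exists $\epsilon>0$ with the property that, for all $t\in K$ and $n\in\mathbb{N}$, $f_n(t)=0$ or $|f_n(t)|\ge\epsilon$. Then there exist $\xi<\omega_1$ and a subsequence of $(f_n)$ which is equivalent to a subsequence of the natural Schauder basis of $X^\xi$.
   Context: Schreier families: to every countable ordinal $\alpha\ge 1$ a sequence of successor ordinals $(\alpha_n+1)_n$ is associated once and for all: if $\alpha$ is a successor, $\alpha_n=\alpha-1$ for all $n$; if $\alpha$ is a limit, $(\alpha_n+1)$ is a (fixed) strictly increasing sequence of ordinals tending to $\alpha$. For finite sets, $E<F$ means $\max E<\min F$. For families $\mathcal{F}_1,\mathcal{F}_2$ of finite subsets of $\mathbb{N}$, $\mathcal{F}_2[\mathcal{F}_1]=\{\bigcup_{i=1}^nG_i: n\in\mathbb{N},\ G_1<\dots<G_n,\ G_i\in\mathcal{F}_1\ \forall i\le n,\ \{\min G_i: i\le n\}\in\mathcal{F}_2\}\cup\{\emptyset\}$. Set $S_0=\{\{n\}:n\in\mathbb{N}\}\cup\{\emptyset\}$, $S_1=\{F\subset\mathbb{N}:|F|\le\min F\}\cup\{\emptyset\}$, $S_{\zeta+1}=S_1[S_\zeta]$, and for $\xi$ a limit ordinal $S_\xi=\bigcup_n\{F\in S_{\xi_n+1}: n\le\min F\}\cup\{\emptyset\}$. The generalized Schreier space $X^\xi$ is the completion of $c_{00}$ (finitely supported scalar sequences) under the norm $\|\sum_ia_ie_i\|_{S_\xi}=\sup\{\sum_{i\in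 F}|a_i|: F\in S_\xi\}$, where $(e_i)$ is the unit vector basis of $c_{00}$; $(e_i)$ is the natural Schauder basis of $X^\xi$. Two basic sequences $(x_n),(y_n)$ are equivalent if $x_n\mapsto y_n$ extends to an isomorphism between their closed linear spans. *)

(* Defs.v *)
From HB Require Import structures.
From mathcomp Require Import all_boot all_order all_algebra finmap.
From mathcomp Require Import all_classical all_reals wochoice topology normedtype.
From mathcomp Require Import complex.

Set Implicit Arguments.
Unset Strict Implicit.
Unset Printing Implicit Defensive.

Import Order.TTheory GRing.Theory Num.Theory.
Import numFieldNormedType.Exports.

Local Open Scope classical_set_scope.

Definition wo_le : rel (set nat) := sval (well_ordering_principle (set nat)).

Lemma wo_leP : well_order wo_le.
Proof. exact: svalP. Qed.

Lemma wo_le_min (A : set (set nat)) : A !=set0 ->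
  exists2 x, A x & forall y, A y -> wo_le x y.
Proof.
case=> a Aa; have [|x [[Ax mx] _]] := wo_leP (A := mem A).
  by exists a; rewrite inE.
exists x; first by move: Ax; rewrite inE.
by move=> y Ay; apply: mx; rewrite inE.
Qed.

Lemma wo_le_total : total wo_le.
Proof.
move=> x y; have [|z [->|->] mz] := wo_le_min (A := [set x; y]).
- by exists x; left.
- by rewrite mz//; right.
- by rewrite orbC mz//; left.
Qed.

Lemma wo_le_anti : antisymmetric wo_le.
Proof.
move=> x y /andP[xy yx]; have [|z [_ u]] := wo_leP (A := mem [set x; y]).
  by exists x; rewrite inE; left.
have xx : wo_le x x by have := wo_le_total x x; rewrite orbb.
have yy : wo_le y y by have := wo_le_total y y; rewrite orbb.
rewrite -(u x); last first.
  by split=> [|t]; rewrite inE; [left|case=> ->].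
by apply: u; split=> [|t]; rewrite inE; [right|case=> ->].
Qed.

Lemma wo_le_trans : transitive wo_le.
Proof.
move=> y x z xy yz; have [|m mA mm] := wo_le_min (A := [set x; y; z]).
  by exists x; left; left.
have mx : wo_le m x by apply: mm; left; left.
have my : wo_le m y by apply: mm; left; right.
have mz : wo_le m z by apply: mm; right.
case: mA mx my mz => [[->|->]|->] // mx my mz.
- by have -> : x = y by apply: wo_le_anti; rewrite xy.
- by have <- : y = z by apply: wo_le_anti; rewrite yz.
Qed.

(* The points of a well-ordering of the (uncountable) type [set nat] having
   countably many predecessors form the least uncountable ordinal. *)
Record omega1 := Omega1 {
  omega1_val : set nat;
  omega1_valP : `[< countable [set z | wo_le z omega1_val] >] }.

HB.instance Definition _ := [isSub for omega1_val].
HB.instance Definition _ := [Choice of omega1 by <:].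

Definition omega1_le (a b : omega1) := wo_le (val a) (val b).

Lemma omega1_le_total : total omega1_le.
Proof. by move=> a b; exact: wo_le_total. Qed.
Lemma omega1_le_refl : reflexive omega1_le.
Proof. by move=> a; have := omega1_le_total a a; rewrite orbb. Qed.
Lemma omega1_le_anti : antisymmetric omega1_le.
Proof. by move=> a b /wo_le_anti /val_inj. Qed.
Lemma omega1_le_trans : transitive omega1_le.
Proof. by move=> b a c; exact: wo_le_trans. Qed.

Fact omega1_display : Order.disp_t. Proof. exact: Order.Disp tt tt. Qed.

HB.instance Definition _ := Order.Le_isPOrder.Build omega1_display omega1
  omega1_le_refl omega1_le_anti omega1_le_trans.
HB.instance Definition _ :=
  Order.POrder_isTotal.Build omega1_display omega1 omega1_le_total.

Local Open Scope order_scope.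

Lemma omega1_min (A : set omega1) : A !=set0 ->
  exists2 a, A a & forall b, A b -> a <= b.
Proof.
case=> a Aa; have [|x [b Ab <-] mx] := wo_le_min (A := val @` A).
  by exists (val a), a.
by exists b => // c Ac; apply: mx; exists c.
Qed.

Lemma omega1_countable (a : omega1) : countable [set b | b <= a].
Proof.
have /asboolP/countable_injP[g gI] := omega1_valP a.
apply/countable_injP; exists (g \o val) => b c.
by rewrite !inE => ba ca /gI; rewrite !inE => /(_ ba ca)/val_inj.
Qed.

Lemma omega1_uncountable : ~ countable [set: omega1].
Proof.
move=> c1.
have cI : countable (range omega1_val) by apply: sub_countable c1; exact: card_image_le.
have [] : (exists x, ~ range omega1_val x).
  apply: contrapT => /forallNP nI.
  have : countable [set: set nat].
    by apply: sub_countable cI; apply: subset_card_le => x _; apply: contrapT; exact: nI.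
  move=> /countable_injP[g gI].
  pose D := [set n | exists2 A, g A = n & ~ A n].
  have nD : ~ D (g D) by move=> /[dup] DD [A /gI]; rewrite !inE => /(_ I I) ->.
  by apply: (nD); exists D.
move=> x0 x0I; have [|m mI mm] := wo_le_min (A := ~` range omega1_val).
  by exists x0.
apply: mI; suff cm : `[< countable [set z | wo_le z m] >] by exists (Omega1 cm).
apply/asboolP; apply: (@sub_countable _ _ _ (range omega1_val `|` [set m])).
  apply: subset_card_le => z /= zm; have [->|/eqP zNm] := eqVneq z m; first by right.
  left; apply: contrapT => zI; apply: zNm; apply: wo_le_anti.
  by rewrite zm mm.
rewrite -bigcup2inE.
apply: bigcup_countable => // -[|[|i]]//= _.
Qed.

Definition is_zero (a : omega1) := forall b : omega1, a <= b.

Definition is_succ (a b : omega1) := a < b /\ forall c, a < c -> b <= c.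

Definition osucc (a : omega1) : omega1 := xget a (is_succ a).

Lemma osuccP (a : omega1) : is_succ a (osucc a).
Proof.
rewrite /osucc; case: xgetP => // Na.
have [|b ab mb] := omega1_min (A := [set b | a < b]); last by case: (Na b).
apply: contrapT => /forallNP Nb; apply: omega1_uncountable.
apply: sub_countable (omega1_countable a); apply: subset_card_le => b _ /=.
by rewrite leNgt; apply/negP/Nb.
Qed.

Lemma osucc_inj : injective osucc.
Proof.
move=> a b eab; have [asa ma] := osuccP a; have [bsb mb] := osuccP b.
by case: (ltgtP a b) => // [/ma|/mb]; rewrite leNgt; [rewrite eab bsb|rewrite -eab asa].
Qed.

Definition is_limit (a : omega1) := ~ is_zero a /\ forall b, a <> osucc b.

(* [fseq a n] is the ordinal alpha_n such that the sequence associated with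
   alpha = a is (alpha_n + 1)_n; nothing is required of [fseq] at 0. *)
Record fundamental_system := FundamentalSystem {
  fseq :> omega1 -> nat -> omega1;
  fseq_succ : forall a n, fseq (osucc a) n = a;
  fseq_limit_incr : forall a, is_limit a ->
    {homo (fun n => osucc (fseq a n)) : m n / (m < n)%N >-> m < n};
  fseq_limit_cvg : forall a, is_limit a ->
    supremums (range (fun n => osucc (fseq a n))) a }.

Local Close Scope order_scope.

Definition fsmax (F : {fset nat}) : nat := \big[maxn/0]_(i <- F) i.

Definition fsmin (F : {fset nat}) : nat := \big[minn/fsmax F]_(i <- F) i.

Definition fset_lt (E F : {fset nat}) := fsmax E < fsmin F.

Definition family_comp (F2 F1 : {fset nat} -> Prop) (F : {fset nat}) : Prop :=
  F = fset0 \/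
  exists Gs : seq {fset nat},
    [/\ F = (\bigcup_(G <- Gs) G)%fset,
        fset0 \notin Gs,
        sorted fset_lt Gs,
        forall G, G \in Gs -> F1 G
      & F2 [fset i in map fsmin Gs]%fset].

Definition schreier0 (F : {fset nat}) : Prop :=
  F = fset0 \/ exists i, F = [fset i]%fset.

(* Positive integers are shifted by one throughout: the natural number i
   stands for the element i + 1 of {1, 2, ...}, so that |F| <= min F reads
   as follows. *)
Definition schreier1 (F : {fset nat}) : Prop :=
  F = fset0 \/ #|` F| <= (fsmin F).+1.

(* Recursion along [omega1], given as an inductive predicate; the defining
   equations are [schreier_zeroE], [schreier_oneE], [schreier_succE] and
   [schreier_limitE]. In the limit clause n and min F are both shifted. *)
Inductive schreier (alpha : fundamental_system) (xi : omega1)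
    (F : {fset nat}) : Prop :=
| Schreier_zero : is_zero xi -> schreier0 F -> schreier alpha xi F
| Schreier_succ zeta : xi = osucc zeta ->
   family_comp schreier1 (schreier alpha zeta) F -> schreier alpha xi F
| Schreier_limit : is_limit xi ->
   (F = fset0 \/
    exists n, schreier alpha (osucc (alpha xi n)) F /\ n <= fsmin F) ->
   schreier alpha xi F.

Lemma is_zero_osucc a : ~ is_zero (osucc a).
Proof. by move=> /(_ a); rewrite leNgt (osuccP a).1. Qed.

Lemma ltn_osucc (a b : omega1) : (a < b)%O -> (osucc a < osucc b)%O.
Proof. by move=> ab; apply: le_lt_trans (osuccP b).1; exact: (osuccP a).2. Qed.

Lemma osucc_lt_limit (a b : omega1) : is_limit a -> (b < a)%O -> (osucc b < a)%O.
Proof.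
move=> [_ la] ba; rewrite lt_neqAle (osuccP b).2// andbT.
by apply/eqP => /esym/la.
Qed.

Lemma fundamental_system_exists : inhabited fundamental_system.
Proof.
have lim a : is_limit a -> exists u : nat -> omega1,
    {homo (fun n => osucc (u n)) : m n / (m < n)%N >-> (m < n)%O} /\
    supremums (range (fun n => osucc (u n))) a.
  move=> la; have [z za] : exists z : omega1, (z < a)%O.
    apply: contrapT => /forallNP h; case: la => + _; apply => b.
    by rewrite leNgt; apply/negP/h.
  have /countable_injP[g gI] := omega1_countable a.
  pose e n := xget z [set b | (b < a)%O /\ g b = n].
  have ea n : (e n < a)%O by rewrite /e; case: xgetP => // b _ [].
  have eg b : (b < a)%O -> e (g b) = b.
    move=> ba; rewrite /e; case: xgetP => [c _ [ca gcb]|/(_ b)]; last by case.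
    by apply: gI => //; rewrite inE /= ltW.
  pose u := fix u n := if n is m.+1 then Order.max (osucc (u m)) (e m.+1) else e 0.
  have ua n : (u n < a)%O.
    by elim: n => //= n ih; rewrite gt_max ea andbT osucc_lt_limit.
  have eu n : (e n <= u n)%O by case: n => //= n; rewrite le_max lexx orbT.
  have uS n : (u n < u n.+1)%O by rewrite /= lt_max (osuccP _).1.
  have uI m n : (m < n)%N -> (osucc (u m) < osucc (u n))%O.
    move=> mn; apply: ltn_osucc; elim: n mn => // n ih.
    by rewrite ltnS leq_eqVlt => /predU1P[->//|/ih]/lt_trans; exact.
  exists u; split=> //; split=> [_ [n _ <-]|b ub]; first exact/ltW/osucc_lt_limit.
  rewrite leNgt; apply/negP => /eg gb.
  have : (osucc (u (g b)) <= b)%O by apply: ub; exists (g b).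
  by rewrite leNgt -{1}gb (le_lt_trans (eu _) (osuccP _).1).
pose P a (u : nat -> omega1) := (forall b, a = osucc b -> forall n, u n = b) /\
  (is_limit a -> {homo (fun n => osucc (u n)) : m n / (m < n)%N >-> (m < n)%O} /\
    supremums (range (fun n => osucc (u n))) a).
have /choice[f fP] : forall a, exists u, P a u.
  move=> a; have [la|nla] := pselect (is_limit a).
    by have [u uP] := lim _ la; exists u; split => // b ab; case: la => _ /(_ b).
  have [[b ab]|nb] := pselect (exists b, a = osucc b).
    by exists (fun=> b); split=> // c; rewrite ab => /osucc_inj.
  by exists (fun=> a); split=> // b ab; case: nb; exists b.
split; apply: (@FundamentalSystem f) => [a n|a /(fP a).2[]//|a /(fP a).2[]//].
exact: (fP _).1.
Qed.

Section schreier_families.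
Variable alpha : fundamental_system.

Lemma schreier_zeroE xi : is_zero xi -> schreier alpha xi = schreier0.
Proof.
move=> xi0; apply/funext => F; apply/propext; split=> [|]; last exact: Schreier_zero.
case=> // [zeta xiE|[]//]; by move: xi0; rewrite xiE => /is_zero_osucc.
Qed.

Lemma schreier_succE zeta :
  schreier alpha (osucc zeta) = family_comp schreier1 (schreier alpha zeta).
Proof.
apply/funext => F; apply/propext; split=> [|]; last exact: Schreier_succ.
by case=> [/is_zero_osucc//|z /osucc_inj <-//|[_ /(_ zeta)]].
Qed.

Lemma schreier_limitE xi : is_limit xi -> schreier alpha xi =
  fun F => F = fset0 \/
    exists n, schreier alpha (osucc (alpha xi n)) F /\ n <= fsmin F.
Proof.
move=> xil; apply/funext => F; apply/propext; split=> [|]; last exact: Schreier_limit.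
by case: (xil) => nz ns; case=> // z /ns.
Qed.

Lemma fsmax1 i : fsmax [fset i]%fset = i.
Proof. by rewrite /fsmax big_seq_fset1. Qed.

Lemma fsmin1 i : fsmin [fset i]%fset = i.
Proof. by rewrite /fsmin enum_fsetE enum_fset1 big_cons big_nil fsmax1 minnn. Qed.

Lemma fset1_neq0 (i : nat) : [fset i]%fset != fset0.
Proof. by apply/fset0Pn; exists i; rewrite inE. Qed.

Lemma schreier_set1 xi i : schreier alpha xi [fset i]%fset.
Proof.
have succ1 zeta : schreier alpha zeta [fset i]%fset ->
    schreier alpha (osucc zeta) [fset i]%fset.
  move=> zi; rewrite schreier_succE; right; exists [:: [fset i]%fset]; split => //.
  - by rewrite big_seq1.
  - by rewrite inE eq_sym fset1_neq0.
  - by move=> G; rewrite inE => /eqP ->.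
  - have -> : [fset j in map fsmin [:: [fset i]]]%fset = [fset i]%fset.
      by apply/fsetP => j; rewrite !inE/= fsmin1 orbF.
    by right; rewrite cardfs1.
have [//|Nxi] := pselect (schreier alpha xi [fset i]%fset).
have [|z Nz zmin] := omega1_min (A := [set z | ~ schreier alpha z [fset i]%fset]).
  by exists xi.
case: Nz; have below y : (y < z)%O -> schreier alpha y [fset i]%fset.
  by move=> yz; apply: contrapT => /zmin; rewrite leNgt yz.
have [z0|Nz0] := pselect (is_zero z).
  by rewrite schreier_zeroE//; right; exists i.
have [[y zE]|Ns] := pselect (exists y, z = osucc y).
  by rewrite zE; apply/succ1/below; rewrite zE; exact: (osuccP y).1.
have zl : is_limit z by split=> // y zE; apply: Ns; exists y.
rewrite schreier_limitE//; right; exists 0; split=> //.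
apply: below; have [ub _] := fseq_limit_cvg alpha zl.
apply: lt_le_trans (_ : osucc (alpha z 1) <= z)%O; last by apply: ub; exists 1.
exact: (fseq_limit_incr alpha zl).
Qed.

Lemma schreier_oneE zeta : is_zero zeta ->
  schreier alpha (osucc zeta) = schreier1.
Proof.
move=> z0; rewrite schreier_succE schreier_zeroE//.
apply/funext => F; apply/propext; split.
  case=> [->|[Gs [FE G0 _ GS]]]; first by left.
  suff -> : [fset i in map fsmin Gs]%fset = F by [].
  rewrite FE; apply/fsetP => i; rewrite !inE; apply/mapP/bigfcupP => -[G].
    move=> GGs iE; exists G; first by rewrite GGs.
    move: G0; case: (GS _ GGs) => [E|[j GE]]; first by rewrite -E GGs.
    by rewrite iE GE fsmin1 inE.
  rewrite andbT => GGs iG; exists G => //.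
  by case: (GS _ GGs) iG => [->|[j ->]]; rewrite inE// => /eqP ->; rewrite fsmin1.
move=> SF; right; exists [seq [fset i]%fset | i <- sort leq F].
have mins : [fset i in map fsmin [seq [fset i]%fset | i <- sort leq F]]%fset = F.
  apply/fsetP => i; rewrite !inE -map_comp (eq_map (g := id)) ?map_id ?mem_sort//.
  exact: fsmin1.
split=> //; last by rewrite mins.
- apply/fsetP => i; apply/idP/bigfcupP => [iF|[_ /andP[/mapP[j + ->] _]]].
    exists [fset i]%fset; last by rewrite inE.
    by rewrite andbT; apply/mapP; exists i => //; rewrite mem_sort.
  by rewrite mem_sort inE => jF /eqP ->.
- by apply/mapP => -[i _ E]; have := fset1_neq0 i; rewrite -E eqxx.
- rewrite sorted_map (eq_sorted (e' := ltn)); last first.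
    by move=> i j; rewrite /= /fset_lt fsmax1 fsmin1.
  by rewrite ltn_sorted_uniq_leq sort_uniq fset_uniq/= sort_sorted//; exact: leq_total.
- by move=> G /mapP[i _ ->]; right; exists i.
Qed.

End schreier_families.

Local Open Scope ring_scope.

Variant scalar_kind := RealScalars | ComplexScalars.

Definition scalar_field (R : realType) (k : scalar_kind) : numFieldType :=
  match k with RealScalars => R | ComplexScalars => R[i]%C end.

Lemma complex_sup (R : realType) (A : set R[i]%C) :
  A `<=` [set x | 0 <= x] -> A !=set0 -> has_ubound A -> supremums A !=set0.
Proof.
move=> A0 [a Aa] [M MA]; pose Re : R[i]%C -> R := @complex.Re R.
have ReE (x : R[i]%C) : 0 <= x -> x = (Re x)%:C%C.
  by move=> /ger0_Im; case: x => /= r i ->.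
have M0 : 0 <= M := le_trans (A0 _ Aa) (MA _ Aa).
pose B := [set Re x | x in A].
have sB : has_sup B.
  split; first by exists (Re a), a.
  exists (Re M) => _ [x Ax <-]; rewrite -lecR -(ReE _ M0) -ReE; first exact: MA.
  exact: A0.
exists (sup B)%:C%C; split=> [x Ax|x ux].
  rewrite (ReE x (A0 _ Ax)) lecR; apply: sup_upper_bound => //.
  by exists x.
have x0 : 0 <= x := le_trans (A0 _ Aa) (ux _ Aa).
rewrite (ReE x x0) lecR; apply: ge_sup; first by exists (Re a), a.
move=> _ [y Ay <-]; rewrite -lecR -(ReE x x0) -ReE; first exact: ux.
exact: A0.
Qed.

Lemma scalar_sup (R : realType) (k : scalar_kind) (A : set (scalar_field R k)) :
  A `<=` [set x | 0 <= x] -> A !=set0 -> has_ubound A -> supremums A !=set0.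
Proof.
case: k A => A; last exact: complex_sup.
move=> _ [a Aa] [M MA]; have sA : has_sup A by split; [exists a|exists M].
exists (sup A); split; first exact: sup_upper_bound.
by move=> x ux; apply: ge_sup => //; exists a.
Qed.

(* Suprema are taken in the scalar field itself (whose order is partial in the
   complex case), because the norm of a [normedModType] is scalar-valued. *)
Section sup_of_seminorms.
Variables (R : realType) (k : scalar_kind).
Local Notation KK := (scalar_field R k).
Variables (V : lmodType KK) (I : Type) (D : set I) (p : I -> V -> KK).

Definition sup_seminorm (v : V) : KK := supremum 0 [set p i v | i in D].

Hypothesis p_ge0 : forall i v, 0 <= p i v.
Hypothesis p_bounded : forall v, has_ubound [set p i v | i in D].
Hypothesis pD : forall i u v, p i (u + v) <= p i u + p i v.
Hypothesis pZ : forall i (l : KK) v, p i (l *: v) = `|l| * p i v.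

Let sup_seminormP v : D !=set0 ->
  supremums [set p i v | i in D] (sup_seminorm v).
Proof.
move=> [i Di]; rewrite /sup_seminorm /supremum ifF; last first.
  by apply/negbTE/set0P; exists (p i v), i.
have [|||s sP] := @scalar_sup R k [set p i v | i in D]; last by apply: xgetPex; exists s.
- by move=> _ [j _ <-]; exact: p_ge0.
- by exists (p i v), i.
- exact: p_bounded.
Qed.

Lemma le_sup_seminorm i v : D i -> p i v <= sup_seminorm v.
Proof.
by move=> Di; have [|ub _] := @sup_seminormP v; [exists i|apply: ub; exists i].
Qed.

Lemma sup_seminorm_le v M : 0 <= M -> (forall i, D i -> p i v <= M) ->
  sup_seminorm v <= M.
Proof.
move=> M0 pM; have [D0|/set0P D0] := eqVneq D set0.
  by rewrite /sup_seminorm D0 image_set0 supremum0.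
by have [_] := sup_seminormP v D0; apply => _ [i Di <-]; exact: pM.
Qed.

Lemma sup_seminorm_ge0 v : 0 <= sup_seminorm v.
Proof.
have [D0|/set0P[i Di]] := eqVneq D set0.
  by rewrite /sup_seminorm D0 image_set0 supremum0.
exact: le_trans (p_ge0 i v) (le_sup_seminorm _ Di).
Qed.

Lemma ler_sup_seminormD u v :
  sup_seminorm (u + v) <= sup_seminorm u + sup_seminorm v.
Proof.
apply: sup_seminorm_le => [|i Di]; first by rewrite addr_ge0// sup_seminorm_ge0.
by rewrite (le_trans (pD _ _ _))// lerD// le_sup_seminorm.
Qed.

Let sup_seminormZ_le l v : sup_seminorm (l *: v) <= `|l| * sup_seminorm v.
Proof.
apply: sup_seminorm_le => [|i Di]; first by rewrite mulr_ge0// sup_seminorm_ge0.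
by rewrite pZ ler_wpM2l// le_sup_seminorm.
Qed.

Lemma sup_seminormZ l v : sup_seminorm (l *: v) = `|l| * sup_seminorm v.
Proof.
apply/eqP; rewrite eq_le sup_seminormZ_le /=.
have [->|l0] := eqVneq l 0; first by rewrite normr0 mul0r sup_seminorm_ge0.
rewrite -ler_pdivlMl ?normr_gt0// -normfV.
by rewrite -{1}[v](scalerK l0) sup_seminormZ_le.
Qed.

End sup_of_seminorms.

Lemma normc_le_ReIm (R : realType) (z : R[i]%C) (r : R) :
  `|complex.Re z| <= r / 2 -> `|complex.Im z| <= r / 2 -> `|z| <= r%:C%C.
Proof.
move=> zR zI; have -> : r = r / 2 + r / 2 by exact: splitr.
rewrite [z]complexE raddfD; apply: le_trans (ler_normD _ _) _; apply: lerD.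
  by rewrite normc_def/= expr0n addr0 sqrtr_sqr lecR.
rewrite normrM [X in X * _]normc_def/= expr0n expr1n add0r sqrtr1 mul1r.
by rewrite normc_def/= expr0n addr0 sqrtr_sqr lecR.
Qed.

Lemma complex_cauchy_cvg (R : realType) (F : set_system (R[i]%C : numFieldType)) :
  ProperFilter F -> cauchy F -> cvg F.
Proof.
move=> FF /cauchyP Fc.
have part (f : (R[i]%C : numFieldType) -> R) :
    (forall x y, `|f x - f y|%:C%C <= `|x - y|) -> cvg (f @ F).
  move=> fl; apply/cauchy_cvgP/cauchyP => e e0.
  have [|x Fx] := Fc e%:C%C; first by rewrite ltcR.
  exists (f x); rewrite /fmap/=; apply: filterS Fx => y; rewrite -!ball_normE /= => xy.
  by have := le_lt_trans (fl x y) xy; rewrite ltcR.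
have /part cR : forall x y : R[i]%C, `|complex.Re x - complex.Re y|%:C%C <= `|x - y|.
  by move=> x y; rewrite -raddfB; exact: normc_ge_Re.
have /part cI : forall x y : R[i]%C, `|complex.Im x - complex.Im y|%:C%C <= `|x - y|.
  move=> x y; rewrite -raddfB; move: (x - y) => [a b].
  rewrite normc_def /= lecR -sqrtr_sqr ler_wsqrtr// lerDr sqr_ge0//.
apply/cvg_ex; exists (lim (@complex.Re R @ F) +i* lim (@complex.Im R @ F))%C.
apply/cvgrPdist_le => e e0; have eE : e = (complex.Re e)%:C%C.
  by move: (ltW e0) => /ger0_Im; case: (e) => /= r i ->.
have r2 : 0 < complex.Re e / 2 by rewrite divr_gt0// -ltcR -eE.
have /cvgrPdist_le/(_ _ r2) hR := cR.
have /cvgrPdist_le/(_ _ r2) hI := cI.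
apply: filterS2 hR hI => -[a b] /= ha hb.
by rewrite eE; apply: normc_le_ReIm; rewrite raddfB.
Qed.

Lemma scalar_cauchy_cvg (R : realType) (k : scalar_kind)
    (F : set_system (scalar_field R k)) :
  ProperFilter F -> cauchy F -> cvg F.
Proof.
by case: k F => F FF; [exact: cauchy_cvg|exact: complex_cauchy_cvg].
Qed.

Section continuous_functions.
Variables (R : realType) (k : scalar_kind) (K : topologicalType).
Local Notation KK := (scalar_field R k).

Definition continuous_pred : {pred K -> KK} := fun f => `[< continuous f >].

(* The space C(K); compactness of K is what makes the sup norm finite. *)
Record Cspace (compactK : compact [set: K]) := MkCspace {
  Cspace_fun :> K -> KK;
  Cspace_funP : Cspace_fun \in continuous_pred }.

Lemma continuous_pred_submod : submod_closed continuous_pred.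
Proof.
split=> [|l f g /asboolP cf /asboolP cg]; apply/asboolP => t.
  exact: cvg_cst.
by apply: cvgD; [apply: cvgZr|]; [exact: cf|exact: cg].
Qed.

HB.instance Definition _ :=
  GRing.isSubmodClosed.Build KK (K -> KK) continuous_pred continuous_pred_submod.

Variable compactK : compact [set: K].
Local Notation C := (Cspace compactK).

HB.instance Definition _ := [isSub for @Cspace_fun compactK].
HB.instance Definition _ := [Choice of C by <:].
HB.instance Definition _ := [SubChoice_isSubLmodule of C by <:].

Definition Cspace_norm : C -> KK :=
  sup_seminorm [set: K] (fun t (f : C) => `|f t|).

Let C_bounded (f : C) : has_ubound [set `|f t| | t in [set: K]].
Proof.
have /asboolP cf := Cspace_funP f.
have : \forall M \near +oo, [set: K] `<=` (fun t => `|f t| <= M).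
  apply: (iffLR (compact_near_coveringP _) compactK) => t _.
  exists ([set u | `|f u| <= `|f t| + 1], [set M | `|f t| + 1 <= M]); last first.
    by move=> [u M] [] /=; exact: le_trans.
  split; last by apply: nbhs_pinfty_ge; rewrite realD// normr_real.
  have /cvgrPdist_le/(_ 1 ltr01) := cf t; apply: filterS => u /= ftu.
  by rewrite -lerBlDl (le_trans (lerB_dist _ _))// distrC.
move=> bM; have [M fM] := filter_ex bM.
by exists M => _ [t _ <-]; exact: fM.
Qed.

Let C_normD (f g : C) : Cspace_norm (f + g) <= Cspace_norm f + Cspace_norm g.
Proof. by apply: ler_sup_seminormD => // t u v; exact: ler_normD. Qed.

Let C_normZ (l : KK) (f : C) : Cspace_norm (l *: f) = `|l| * Cspace_norm f.
Proof. by apply: sup_seminormZ => // t m u; exact: normrM. Qed.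

Let C_norm0_eq0 (f : C) : Cspace_norm f = 0 -> f = 0.
Proof.
move=> f0; apply/val_inj/funext => t; apply/eqP; rewrite -normr_le0 -f0.
exact: (le_sup_seminorm (p := fun t (f : C) => `|f t|)).
Qed.

HB.instance Definition _ :=
  @Lmodule_isNormed.Build KK C Cspace_norm C_normD C_normZ C_norm0_eq0.

Lemma Cspace_normE (f : C) : `|f| = supremum 0 [set `|f t| | t in [set: K]].
Proof. by []. Qed.

End continuous_functions.

Section schreier_space.
Variables (R : realType) (k : scalar_kind).
Variables (alpha : fundamental_system) (xi : omega1).
Local Notation KK := (scalar_field R k).
Local Notation S := (schreier alpha xi : set {fset nat}).

Definition c00 : set (nat -> KK) :=
  [set b | exists N, forall i, (N <= i)%N -> b i = 0].

(* The completion of [c00] is realised as the space of the scalar sequences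
   approximable by [c00] in the Schreier norm: see [Xspace_normE], [c00_dense]
   and [Xspace_cauchy_cvg]. Bounding every sum, rather than their [supremum],
   avoids the junk value of the latter on unbounded sets. *)
Definition schreier_pred : {pred nat -> KK} := fun a =>
  `[< forall e : KK, 0 < e -> exists2 b, c00 b &
        forall F, S F -> \sum_(i <- F) `|a i - b i| <= e >].

Record Xspace := MkXspace {
  Xspace_fun :> nat -> KK;
  Xspace_funP : Xspace_fun \in schreier_pred }.

Lemma c00_schreier_pred b : c00 b -> b \in schreier_pred.
Proof.
move=> cb; apply/asboolP => e e0; exists b => // F _.
by rewrite big1 ?ltW// => i _; rewrite subrr normr0.
Qed.

Lemma unit_vector_c00 i : c00 (fun j => (j == i)%:R : KK).
Proof. by exists i.+1 => j; case: eqP => // -> /[!ltnn]. Qed.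

Lemma schreier_pred_submod : submod_closed schreier_pred.
Proof.
split=> [|l a1 a2 /asboolP Pa1 /asboolP Pa2].
  by apply: c00_schreier_pred; exists 0%N.
apply/asboolP => e e0.
have l1 : 0 < `|l| + 1 by rewrite ltr_wpDl.
have e2 : 0 < e / 2 by rewrite divr_gt0.
have [b1 [N1 b1N] ab1] := Pa1 (e / 2 / (`|l| + 1)) (divr_gt0 e2 l1).
have [b2 [N2 b2N] ab2] := Pa2 _ e2.
exists (l *: b1 + b2).
  exists (maxn N1 N2) => i; rewrite geq_max => /andP[i1 i2].
  by rewrite !fctE b1N// b2N// scaler0 addr0.
move=> F SF; apply: (@le_trans _ _ (\sum_(i <- F) (`|l| * `|a1 i - b1 i| + `|a2 i - b2 i|))).
  apply: ler_sum => i _; rewrite -normrM !fctE opprD addrACA mulrBr.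
  exact: ler_normD.
rewrite big_split/= -mulr_sumr [leRHS]splitr lerD// ?ab2//.
apply: (@le_trans _ _ ((`|l| + 1) * (\sum_(i <- F) `|a1 i - b1 i|))).
  by rewrite ler_wpM2r ?sumr_ge0// lerDl.
by rewrite -ler_pdivlMl// mulrC ab1.
Qed.

HB.instance Definition _ :=
  GRing.isSubmodClosed.Build KK (nat -> KK) schreier_pred schreier_pred_submod.
HB.instance Definition _ := [isSub for Xspace_fun].
HB.instance Definition _ := [Choice of Xspace by <:].
HB.instance Definition _ := [SubChoice_isSubLmodule of Xspace by <:].

Definition Xspace_norm : Xspace -> KK :=
  sup_seminorm S (fun F (a : Xspace) => \sum_(i <- F) `|a i|).

Lemma Xspace_sum_ge0 (F : {fset nat}) (a : Xspace) : 0 <= \sum_(i <- F) `|a i|.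
Proof. exact: sumr_ge0. Qed.

Lemma Xspace_bounded (a : Xspace) : has_ubound [set \sum_(i <- F) `|a i| | F in S].
Proof.
have /asboolP/(_ 1 ltr01)[b [N bN] ab] := Xspace_funP a.
exists (1 + \sum_(0 <= i < N) `|b i|) => _ [F SF <-].
apply: (@le_trans _ _ (\sum_(i <- F) (`|a i - b i| + `|b i|))).
  by apply: ler_sum => i _; rewrite -{1}(subrK (b i) (a i)) ler_normD.
rewrite big_split lerD ?ab//=.
rewrite (bigID (fun i => i < N)%N)/= [X in _ + X]big1 ?addr0; last first.
  by move=> i; rewrite -leqNgt => /bN ->; rewrite normr0.
rewrite -big_filter.
rewrite (perm_big [seq i <- index_iota 0 N | i \in F])/=; last first.
  apply: uniq_perm => [||i]; rewrite ?filter_uniq ?fset_uniq ?iota_uniq//.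
  by rewrite !mem_filter mem_index_iota andbC.
rewrite big_filter big_mkcond/=; apply: ler_sum => i _.
by case: ifP.
Qed.

Let X_normD (a b : Xspace) : Xspace_norm (a + b) <= Xspace_norm a + Xspace_norm b.
Proof.
apply: ler_sup_seminormD => [F u|u|F u v]; first exact: Xspace_sum_ge0.
  exact: Xspace_bounded.
rewrite -big_split/=.
by apply: ler_sum => i _; exact: ler_normD.
Qed.

Let X_normZ (l : KK) (a : Xspace) : Xspace_norm (l *: a) = `|l| * Xspace_norm a.
Proof.
apply: sup_seminormZ => [F u|u|F m u]; first exact: Xspace_sum_ge0.
  exact: Xspace_bounded.
rewrite mulr_sumr.
by apply: eq_bigr => i _; exact: normrM.
Qed.

Let X_norm0_eq0 (a : Xspace) : Xspace_norm a = 0 -> a = 0.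
Proof.
move=> a0; apply/val_inj/funext => i; apply/eqP; rewrite -normr_le0 -a0.
rewrite (_ : `| _ | = \sum_(j <- [fset i]%fset) `|a j|); last by rewrite big_seq_fset1.
apply: (le_sup_seminorm (D := S) (p := fun F (a : Xspace) => \sum_(j <- F) `|a j|)).
- exact: Xspace_sum_ge0.
- exact: Xspace_bounded.
- exact: schreier_set1.
Qed.

HB.instance Definition _ :=
  @Lmodule_isNormed.Build KK Xspace Xspace_norm X_normD X_normZ X_norm0_eq0.

Lemma Xspace_normE (a : Xspace) :
  `|a| = supremum 0 [set \sum_(i <- F) `|a i| | F in S].
Proof. by []. Qed.

Lemma Xspace_norm_ge (a : Xspace) F : S F -> \sum_(i <- F) `|a i| <= `|a|.
Proof.
apply: (le_sup_seminorm (D := S) (p := fun F (a : Xspace) => \sum_(j <- F) `|a j|)).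
- exact: Xspace_sum_ge0.
- exact: Xspace_bounded.
Qed.

Lemma Xspace_norm_le (a : Xspace) M : 0 <= M ->
  (forall F, S F -> \sum_(i <- F) `|a i| <= M) -> `|a| <= M.
Proof.
apply: (sup_seminorm_le (D := S) (p := fun F (a : Xspace) => \sum_(j <- F) `|a j|)).
- exact: Xspace_sum_ge0.
- exact: Xspace_bounded.
Qed.

Lemma Xspace_coord_le (a : Xspace) i : `|a i| <= `|a|.
Proof.
have := Xspace_norm_ge a (schreier_set1 alpha xi i).
by rewrite big_seq_fset1.
Qed.

Lemma c00_dense : closure [set a : Xspace | c00 a] = [set: Xspace].
Proof.
apply/seteqP; split=> // a _ B /nbhs_ballP[e /= e0 eB].
have /asboolP/(_ (e / 2))[|b cb ab] := Xspace_funP a; first by rewrite divr_gt0.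
exists (MkXspace (c00_schreier_pred cb)); split=> //; apply: eB.
rewrite -ball_normE /=; apply: le_lt_trans (_ : e / 2 < _); last first.
  by rewrite ltr_pdivrMr// mulr2n mulrDr mulr1 ltrDl.
by apply: Xspace_norm_le => //; rewrite divr_ge0// ltW.
Qed.

Lemma Xspace_cauchy_cvg (G : set_system Xspace) :
  ProperFilter G -> cauchy G -> cvg G.
Proof.
move=> GG /cauchyP Gc.
have coord i : cvg ((fun a : Xspace => a i) @ G).
  apply: scalar_cauchy_cvg; apply/cauchyP => e e0; have [x Gx] := Gc e e0.
  exists (x i); rewrite /fmap/=; apply: filterS Gx => y; rewrite -!ball_normE /=.
  exact/le_lt_trans/(Xspace_coord_le (x - y)).
pose a i : KK := lim ((fun a : Xspace => a i) @ G).
have near e : 0 < e -> exists2 x : Xspace, G (ball x e) &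
    forall F, S F -> \sum_(i <- F) `|x i - a i| <= e + e.
  move=> e0; have [x Gx] := Gc e e0; exists x => // F SF.
  pose d := e / (#|` F|%:R + 1).
  have F1 : 0 < #|` F|%:R + 1 :> KK by rewrite ltr_wpDl.
  have d0 : 0 < d by rewrite divr_gt0.
  have Gd : G [set y : Xspace | forall i, i \in F -> `|a i - y i| <= d].
    have : \forall y \near G, forall i : F, `|a (val i) - (y : Xspace) (val i)| <= d.
      apply: filter_forall => i.
      by have /cvgrPdist_le/(_ _ d0) := coord (val i).
    by apply: filterS => y ya i iF; have := ya [` iF]%fset.
  have [y [+ ya]] := filter_ex (filterI Gx Gd).
  rewrite -ball_normE /= => /ltW xy.
  apply: (@le_trans _ _ (\sum_(i <- F) (`|(x - y) i| + `|a i - y i|))).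
    apply: ler_sum => i _; rewrite (distrC (a i)).
    by rewrite (le_trans _ (ler_normD _ _))// addrA subrK.
  rewrite big_split/=; apply: lerD; first exact: le_trans (Xspace_norm_ge _ SF) xy.
  apply: (@le_trans _ _ (\sum_(i <- F) d)).
    by rewrite big_seq [leRHS]big_seq; apply: ler_sum => i iF; exact: ya.
  rewrite big_const_seq count_predT iter_addr_0 -mulr_natr.
  by rewrite mulrAC ler_pdivrMr// ler_wpM2l ?(ltW e0)// lerDl.
have aP : a \in schreier_pred.
  apply/asboolP => e e0; have e3 : 0 < e / 3%:R by rewrite divr_gt0.
  have [x _ xa] := near _ e3.
  have /asboolP/(_ _ e3)[b cb xb] := Xspace_funP x.
  exists b => // F SF.
  apply: (@le_trans _ _ (\sum_(i <- F) (`|x i - a i| + `|x i - b i|))).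
    apply: ler_sum => i _; rewrite (distrC _ (a i)).
    by rewrite (le_trans _ (ler_normD _ _))// addrA subrK.
  have -> : e = e / 3%:R + e / 3%:R + e / 3%:R.
    by rewrite -[LHS](@divfK _ 3%:R) ?pnatr_eq0// mulr_natr mulrS mulr2n addrA.
  by rewrite big_split lerD ?xa ?xb.
apply/cvg_ex; exists (MkXspace aP); apply/cvgrPdist_le => e e0.
have e3 : 0 < e / 3%:R by rewrite divr_gt0.
have [x Gx xa] := near _ e3; apply: filterS Gx => y; rewrite -ball_normE/= => /ltW xy.
have -> : e = e / 3%:R + e / 3%:R + e / 3%:R.
  by rewrite -[LHS](@divfK _ 3%:R) ?pnatr_eq0// mulr_natr mulrS mulr2n addrA.
rewrite -(subrK x (MkXspace aP)) -addrA (le_trans (ler_normD _ _))// lerD//.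
apply: Xspace_norm_le => [|F SF]; first by rewrite addr_ge0// ltW.
by apply: le_trans (xa F SF); apply: ler_sum => i _; rewrite distrC.
Qed.

HB.instance Definition _ := Uniform_isComplete.Build Xspace Xspace_cauchy_cvg.

Definition Xspace_basis (i : nat) : Xspace :=
  MkXspace (c00_schreier_pred (unit_vector_c00 i)).

End schreier_space.

Definition weakly_null (KK : numFieldType) (V : normedModType KK)
    (x : nat -> V) : Prop :=
  forall phi : {linear V -> KK^o}, continuous phi ->
    (fun n => phi (x n)) @ \oo --> (0 : KK^o).

Definition lin_span (KK : numFieldType) (V : normedModType KK) (x : nat -> V) :
    set V :=
  [set v | exists (n : nat) (c : nat -> KK), v = \sum_(i < n) c i *: x i].

Definition closed_span (KK : numFieldType) (V : normedModType KK)
  (x : nat -> V) : set V := closure (lin_span x).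

Definition equivalent (KK : numFieldType) (V W : normedModType KK)
    (x : nat -> V) (y : nat -> W) : Prop :=
  exists (T : V -> W) (U : W -> V),
    [/\ forall (c : KK) (u v : V), closed_span x u -> closed_span x v ->
           T (c *: u + v) = c *: T u + T v,
        set_bij (closed_span x) (closed_span y) T
        /\ {in closed_span x, cancel T U},
        {within closed_span x, continuous T},
        {within closed_span y, continuous U}
      & forall n, T (x n) = y n].

(* Main.v *)
Require Import Defs.
From HB Require Import structures.
From mathcomp Require Import all_boot all_order all_algebra finmap.
From mathcomp Require Import all_classical all_reals topology normedtype.
From mathcomp Require Import complex ring.
Import Order.TTheory GRing.Theory Num.Theory.
Import numFieldNormedType.Exports.

Set Implicit Arguments.
Unset Strict Implicit.
Unset Printing Implicit Defensive.

Local Open Scope classical_set_scope.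

(**
Let A_t = {n : f_n(t) <> 0} and let F be the hereditary family generated by the
sets A_t. The gap makes t |-> A_t continuous, so by compactness of K and weak
nullness no infinite set has all of its finite subsets in F.

Unconditionality. Cut the scalars into finitely many narrow cones. By Galvin's
lemma there is an infinite M such that any finite B in A_t cap M on which the
values f_n(t) lie in a single cone is, within a prescribed finite subset of M,
exactly the support of some t', with f_n(t') in the same cone for n in B. Since
there is no cancellation inside a product of two narrow cones, sum_{n in B} |a_n|
is dominated by the norm of sum_n a_n f_n for every B in F with B in M.

Schreier families. Let xi be the least ordinal such that, on some infinite
subset of M, every member of F is a union of at most k members of S_xi, k being
fixed. Such a xi exists: otherwise Gasparis' dichotomy embeds every S_xi into F,
and F would have an infinite branch. By minimality of xi, the dichotomy and a
diagonal argument, A minus its least element belongs to F for each A in S_xi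
contained in a further infinite subset. Hence both norms are equivalent along
the same subsequence.
*)

(** * Ramsey theory for families of finite sets *)

Definition unbounded (M : set nat) := forall n, exists2 m, M m & (n <= m)%N.

Definition above (s : {fset nat}) : set nat :=
  [set j | forall i, i \in s -> (i < j)%N].

Definition initial_segment (B : {fset nat}) (L : set nat) :=
  exists n, forall i, (i \in B) <-> L i /\ (i < n)%N.

Lemma fset_bound (s : {fset nat}) : exists b, forall i, i \in s -> (i < b)%N.
Proof.
exists (\max_(i <- s) i).+1 => i si; rewrite ltnS.
exact: (leq_bigmax_seq (F := id)).
Qed.

Lemma unbounded_gt M n : unbounded M -> unbounded (M `&` [set j | (n < j)%N]).
Proof.
move=> uM k; have [m Mm km] := uM (maxn k n.+1).
by move: km; rewrite geq_max => /andP[km nm]; exists m.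
Qed.

Lemma unbounded_above M s : unbounded M -> unbounded (M `&` above s).
Proof.
move=> uM; have [b sb] := fset_bound s.
move=> n; have [m [Mm bm] nm] := unbounded_gt b uM n.
by exists m => //; split=> // i /sb /ltn_trans; apply.
Qed.

Lemma truncation (L : set nat) n :
  exists B : {fset nat}, forall i, (i \in B) <-> L i /\ (i < n)%N.
Proof.
exists [fset i in iota 0 n | `[< L i >]]%fset => i.
rewrite !inE /= mem_iota add0n /=; split=> [/andP[? /asboolP]//|[Li ->]].
by apply/asboolP.
Qed.

Lemma fset_ind_max (P : {fset nat} -> Prop) : P fset0 ->
  (forall s m, P s -> above s m -> P (m |` s)%fset) -> forall s, P s.
Proof.
move=> P0 PS s; have [b] := fset_bound s.
elim: b s => [|b IH] s sb.
  by rewrite (_ : s = fset0)//; apply/fsetP => i; rewrite inE; apply/negP => /sb.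
have [bs|bs] := boolP (b \in s); last first.
  apply: IH => i is_; have := sb _ is_; rewrite ltnS leq_eqVlt => /predU1P[ib|//].
  by rewrite -ib is_ in bs.
rewrite -(fsetD1K bs).
have ab : above (s `\ b)%fset b.
  move=> i; rewrite !inE => /andP[ib /sb].
  by rewrite ltnS leq_eqVlt (negbTE ib).
by apply: PS => //; exact: IH.
Qed.

(** Shrink once for each entry of [r]; the properties already secured survive because they pass to
    subsets. *)
Lemma dense_all (I : eqType) (Q : I -> set nat -> Prop) N (r : seq I) :
  (forall i X Y, Y `<=` X -> Q i X -> Q i Y) ->
  (forall i X, X `<=` N -> unbounded X ->
    exists Y, [/\ Y `<=` X, unbounded Y & Q i Y]) ->
  unbounded N ->
  exists M, [/\ M `<=` N, unbounded M & forall i, i \in r -> Q i M].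
Proof.
move=> Qsub Qdense uN; elim: r => [|i r [Y [YN uY QY]]].
  by exists N; split=> // i; rewrite inE.
have [Z [ZY uZ QZ]] := Qdense i Y YN uY.
exists Z; split=> //; first exact: subset_trans YN.
by move=> j; rewrite inE => /predU1P[->//|/QY]; exact: Qsub.
Qed.

(** Diagonal argument: [m k] is picked in [X k], and [X k.+1] is a subset of [X k] beyond [m k]
    satisfying [Q (m k)]. Any chosen point beyond [m k] is some [m j] with j > k, hence lies in
    [X k.+1]. *)
Lemma fusion (Q : nat -> set nat -> Prop) N :
  (forall m X Y, Y `<=` X -> Q m X -> Q m Y) ->
  (forall m X, X `<=` N -> unbounded X ->
    exists Y, [/\ Y `<=` X, unbounded Y & Q m Y]) ->
  unbounded N -> exists M, [/\ M `<=` N, unbounded M &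
    forall m, M m -> Q m (M `&` [set j | (m < j)%N])].
Proof.
move=> Qsub Qdense uN.
have /choice[g gP] (X : set nat) : exists p : nat * set nat,
    X `<=` N /\ unbounded X ->
    [/\ X p.1, p.2 `<=` X `&` [set j | (p.1 < j)%N], unbounded p.2 & Q p.1 p.2].
  have [[XN uX]|?] := pselect (X `<=` N /\ unbounded X); last by exists (0, set0).
  have [m Xm _] := uX 0.
  have [|Y [YX uY QY]] := Qdense m _ _ (unbounded_gt m uX); first by move=> i [/XN].
  by exists (m, Y).
pose X k := iter k (fun X => (g X).2) N; pose m k := (g (X k)).1.
have uX k : X k `<=` N /\ unbounded (X k).
  elim: k => [|k]; first by split.
  by move=> /[dup] -[XN _] /gP[_ XX uX _]; split=> // i /XX[/XN].
have Xm k : X k (m k) by have [] := gP _ (uX k).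
have XS k : X k.+1 `<=` X k `&` [set j | (m k < j)%N] by have [] := gP _ (uX k).
have Xle j k : (j <= k)%N -> X k `<=` X j.
  move=> /subnK <-; elim: (k - j)%N => // d IH i.
  by rewrite addSn => /XS[/IH].
have mlt j k : (j < k)%N -> (m j < m k)%N.
  by move=> jk; have [] := XS j _ (Xle _ _ jk _ (Xm k)).
have mge k : (k <= m k)%N by elim: k => // k /leq_ltn_trans; apply; exact: mlt.
exists (range m); split.
- by move=> _ [k _ <-]; apply: (Xle 0 k).
- by move=> n; exists (m n) => //; exists n.
- move=> _ [k _ <-]; apply: Qsub (_ : Q (m k) (X k.+1)); last by have [] := gP _ (uX k).
  move=> _ [[j _ <-] /= kj]; suff kj' : (k < j)%N by exact: (Xle _ _ kj' _ (Xm j)).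
  by rewrite ltnNge; apply/negP; rewrite leq_eqVlt => /predU1P[jk|/mlt];
     [move: kj; rewrite jk ltnn|rewrite ltnNge ltnW].
Qed.

(** Only finitely many sets have maximum at most m, so stage m of [fusion] can settle all of them.
    The empty set, having no maximum, is settled beforehand. *)
Lemma fusion_fset (Q : {fset nat} -> set nat -> Prop) :
  (forall s X Y, Y `<=` X -> Q s X -> Q s Y) ->
  (forall s X, unbounded X -> exists Y, [/\ Y `<=` X, unbounded Y & Q s Y]) ->
  forall N, unbounded N -> exists M, [/\ M `<=` N, unbounded M &
    forall s : {fset nat}, [set` s] `<=` M -> Q s (M `&` above s)].
Proof.
move=> Qsub Qdense N uN; have [N' [N'N uN' Q0]] := Qdense fset0 N uN.
have [] := @fusion (fun m X => forall s : {fset nat},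
    (forall i, i \in s -> (i <= m)%N) -> Q s X) N' _ _ uN'.
- by move=> m X Y YX QX s /QX; exact: Qsub.
- move=> m X _ uX; have [Y [YX uY QY]] := dense_all
    (fpowerset [fset i in iota 0 m.+1]%fset) Qsub (fun s X _ => Qdense s X) uX.
  exists Y; split=> // s sm; apply: QY.
  rewrite fpowersetE; apply/fsubsetP => i /sm im.
  by rewrite in_fset /= -[0 :: _]/(iota 0 m.+1) mem_iota.
move=> M [MN' uM QM]; exists M; split=> //; first exact: subset_trans N'N.
elim/fset_ind_max => [|s m _ sm] sM.
  by apply: Qsub Q0 => i [/MN'].
apply: Qsub (QM m _ (m |` s)%fset _).
- by move=> i [Mi ai]; split=> //; apply: ai; rewrite !inE eqxx.
- by apply: sM; rewrite /= !inE eqxx.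
- by move=> i; rewrite !inE => /predU1P[->//|/sm/ltnW].
Qed.

Section galvin.
Variable G : {fset nat} -> Prop.

(** Acceptance and rejection as in the combinatorics of Nash-Williams and Galvin-Prikry. A set that
    does not reject [s] contains an infinite one accepting it, and rejection passes to infinite
    subsets, so [s] can always be decided by shrinking. *)
Let accepts (N : set nat) (s : {fset nat}) := forall L, unbounded L ->
  L `<=` N `&` above s -> exists2 B, G B & initial_segment B ([set` s] `|` L).

Let rejects N s := forall N', unbounded N' -> N' `<=` N -> ~ accepts N' s.

Let accepts_sub N N' s : N' `<=` N `|` ~` above s -> accepts N s -> accepts N' s.
Proof.
move=> N'N aN L uL LN'; apply: aN => // i Li.
by have [/N'N[]] := LN' _ Li.
Qed.

Let rejects_sub N N' s : N' `<=` N -> rejects N s -> rejects N' s.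
Proof. by move=> N'N rN X uX XN'; apply: rN => //; exact: subset_trans N'N. Qed.

(** Shrink first to a set [M] deciding all of its finite subsets. If the empty set is accepted, the
    second alternative holds. If it is rejected, a rejected set has only finitely many accepted
    one-point end-extensions; a second fusion avoids these, so that all finite subsets of [M'] are
    rejected, and none of them can belong to [G]. *)
Lemma galvin N : unbounded N -> exists M, [/\ M `<=` N, unbounded M &
  (forall s : {fset nat}, [set` s] `<=` M -> ~ G s) \/
  (forall L, unbounded L -> L `<=` M ->
     exists2 B, G B & initial_segment B L)].
Proof.
move=> uN.
have [| |M [MN uM dM]] := @fusion_fset (fun s X => accepts X s \/ rejects X s) _ _ N uN.
- move=> s X Y YX [aX|rX]; [left|right; exact: rejects_sub YX rX].
  by apply: accepts_sub aX => i /YX; left.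
- move=> s X uX; have [rX|] := pselect (rejects X s); first by exists X; split=> //; right.
  move=> /existsNP[Y] /not_implyP[uY] /not_implyP[YX] /contrapT aY.
  by exists Y; split=> //; left.
(* Acceptance of [s] involves only points beyond [s], so a decision by the tail of [M] is a decision
   by [M]. *)
have {}dM s : [set` s] `<=` M -> accepts M s \/ rejects M s.
  move=> /dM[aM|rM]; [left|right].
    apply: accepts_sub aM => i Mi.
    by have [|] := pselect (above s i); [left|right].
  move=> X uX XM aX; apply: (rM (X `&` above s)).
  - exact: unbounded_above.
  - by move=> i [/XM].
  - by apply: accepts_sub aX => i []; left.
have [|a0|r0] := dM fset0; first by move=> i /=; rewrite inE.
  exists M; split=> //; right => L uL LM.
  have [i Li|B GB iB] := a0 L uL; first by split; [exact: LM|move=> j; rewrite inE].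
  exists B => //; congr initial_segment: iB.
  by apply/seteqP; split=> [i /= []|i]; rewrite ?inE//; right.
have step s : [set` s] `<=` M -> rejects M s -> exists n, forall m, M m ->
    above s m -> (n <= m)%N -> rejects M (m |` s)%fset.
  move=> sM rs; apply: contrapT => /forallNP nb.
  (* If infinitely many extensions were accepted, [Z] would accept [s]: for an infinite [L] inside
     [Z], use the acceptance of [s] extended by the least element of [L]. *)
  pose Z := [set m | [/\ M m, above s m & accepts M (m |` s)%fset]].
  apply: (rs Z) => [n|i []//|].
    have /existsNP[m] := nb n; move=> /not_implyP[Mm] /not_implyP[am] /not_implyP[nm].
    have [|aZ|//] := dM (m |` s)%fset; last by exists m.
    by move=> i /=; rewrite !inE => /predU1P[->//|/sM].
  move=> L uL LZ.
  have exL : exists m, `[< L m >] by have [m Lm _] := uL 0; exists m; apply/asboolP.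
  case: (ex_minnP exL) => m /asboolP Lm Lmin.
  have [[Mm sm am] _] := LZ _ Lm.
  have [| |B GB iB] := am (L `&` [set j | (m < j)%N]).
  - exact: unbounded_gt.
  - move=> i [Li mi]; have [[Mi si _] _] := LZ _ Li.
    by split=> // j; rewrite !inE => /predU1P[->//|/si].
  exists B => //; congr initial_segment: iB.
  apply/seteqP; split=> [i /= [|[Li _]]|i /= [si|Li]]; rewrite ?inE.
  - by case/predU1P => [->|]; [right|left].
  - by right.
  - by left; rewrite si orbT.
  - have [->|im] := eqVneq i m; [by left|right; split=> //].
    by rewrite ltn_neqAle eq_sym im Lmin//; apply/asboolP.
have [||M' [M'M uM' stepM']] := @fusion_fset (fun s X => [set` s] `<=` M -> rejects M s ->
    forall m, X m -> M m -> above s m -> rejects M (m |` s)%fset) _ _ M uM.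
- by move=> s X Y YX QX sM rs m /YX; exact: QX.
- move=> s X uX; have [[sM rs]|n] := pselect ([set` s] `<=` M /\ rejects M s).
    have [n nP] := step s sM rs.
    exists (X `&` [set j | (n < j)%N]); split; [by move=> i []|exact: unbounded_gt|].
    by move=> _ _ m [_ /ltnW nm] Mm sm; exact: nP.
  by exists X; split=> // sM rs; case: n.
exists M'; split=> //; first exact: subset_trans MN.
left; suff rej s : [set` s] `<=` M' -> rejects M s.
  (* A member [s] of [G] is itself an initial segment of [s] followed by any [L] beyond it, so [M]
     would accept it. *)
  move=> s sM' Gs; apply: (rej s sM' M) => // L uL LM; exists s => //.
  have [b sb] := fset_bound s.
  have [l Ll bl] := uL b; have exL : exists m, `[< L m >] by exists l; apply/asboolP.
  case: (ex_minnP exL) => m /asboolP Lm Lmin.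
  have [_ sm] := LM _ Lm; exists m => i /=; split=> [si|[[//|Li]]].
    by split; [left|exact: sm].
  by rewrite ltnNge Lmin//; apply/asboolP.
elim/fset_ind_max: s => // s m IH sm smM'.
have sM' : [set` s] `<=` M' by move=> i si; apply: smM'; rewrite /= !inE [i \in s]si orbT.
have M'm : M' m by apply: smM'; rewrite /= !inE eqxx.
by apply: (stepM' s sM') => //; [exact: subset_trans M'M|exact: IH|exact: M'M].
Qed.

End galvin.

Definition hereditary (F : {fset nat} -> Prop) :=
  forall A B : {fset nat}, (B `<=` A)%fset -> F A -> F B.

(** Apply Galvin's lemma to the members of [F] outside [G]. In the second alternative, take [A] in
    [G] and continue it by the tail of [M]: an initial segment [B] in [F] but not in [G] cannot be
    contained in [A], so it contains [A], and [A] is in [F]. *)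
Lemma family_dichotomy F G : hereditary F -> hereditary G ->
  forall N, unbounded N -> exists M, [/\ M `<=` N, unbounded M &
    (forall A : {fset nat}, [set` A] `<=` M -> F A -> G A) \/
    (forall A : {fset nat}, [set` A] `<=` M -> G A -> F A)].
Proof.
move=> hF hG N uN.
have [M [MN uM alt]] := galvin (fun A => F A /\ ~ G A) uN.
exists M; split=> //; case: alt => [noFG|alw]; [left|right] => A AM.
  by move=> FA; apply: contrapT => nGA; exact: (noFG A AM).
move=> GA; pose L := [set` A] `|` (M `&` above A).
have [n|i [/AM//|[]//]|B [FB nGB] [n Bn]] := alw L.
  by have [m ? ?] := unbounded_above A uM n; exists m => //; right.
have [AB|/fsubsetPn[a aA aB]] := boolP (A `<=` B)%fset; first exact: hF FB.
case: nGB; apply: hG GA; apply/fsubsetP => i /Bn[[//|[_ Ai]] iN].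
by case/negP: aB; apply/Bn; split; [left|exact: ltn_trans (Ai _ aA) iN].
Qed.

(** * Realising subsets of supports as exact supports *)

Section unconditionality.
Variables (T : Type) (A : T -> set nat).
Hypothesis A_compact : forall Z, unbounded Z ->
  ~ (forall s : {fset nat}, [set` s] `<=` Z -> exists t, [set` s] `<=` A t).

(* If m were essential for infinitely many m, fix finitely many of these and a set
   L beyond them: the point t obtained from the longest of the initial segments of
   L that witness this has all of the chosen m in A t. *)
Lemma removable (G : T -> set nat) (p q : {fset nat}) N : unbounded N ->
  exists M, [/\ M `<=` N, unbounded M & forall m, M m ->
    forall B : {fset nat}, [set` B] `<=` M `&` [set j | (m < j)%N] ->
    (exists t, A t `&` [set` p] = [set` q] /\ [set` (q `|` B)%fset] `<=` G t) ->
    exists t, [/\ A t `&` [set` p] = [set` q], ~ A t m &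
                  [set` (q `|` B)%fset] `<=` G t]].
Proof.
move=> uN.
pose E t (B : {fset nat}) :=
  A t `&` [set` p] = [set` q] /\ [set` (q `|` B)%fset] `<=` G t.
pose H m B := (exists t, E t B) /\ (forall t, E t B -> A t m).
have EB t (B C : {fset nat}) : (B `<=` C)%fset -> E t C -> E t B.
  move=> BC [tp tC]; split=> // i; rewrite /= inE => /orP[qi|Bi]; apply: tC; rewrite /= inE ?qi//.
  by rewrite (fsubsetP BC _ Bi) orbT.
pose none m X := forall s : {fset nat}, [set` s] `<=` X -> ~ H m s.
pose all m X := forall L, unbounded L -> L `<=` X -> exists2 B, H m B & initial_segment B L.
have [||M [MN uM alt]] := @fusion (fun m X => none m X \/ all m X) N _ _ uN.
- move=> m X Y YX [nX|aX]; [left|right].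
    by move=> s sY; apply: nX; exact: subset_trans YX.
  by move=> L uL LY; apply: aX => //; exact: subset_trans YX.
- by move=> m X _ uX; exact: galvin.
pose Z := [set m | M m /\ all m (M `&` [set j | (m < j)%N])].
have [n Zn] : exists n, forall m, Z m -> (m < n)%N.
  apply: contrapT => /forallNP nb; apply: (@A_compact Z) => [n|s sZ].
    have /existsNP[m /not_implyP[Zm /negP]] := nb n; rewrite -leqNgt => nm.
    by exists m.
  have [->|/fset0Pn[m0 m0s]] := eqVneq s fset0.
    have [m [Mm am]] : exists m, Z m.
      by have /existsNP[m /not_implyP[Zm _]] := nb 0; exists m.
    have [|//|B [[t _] _] _] := am (M `&` [set j | (m < j)%N]); first exact: unbounded_gt.
    by exists t => i /=; rewrite inE.
  pose L := M `&` above s.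
  have uL : unbounded L by exact: unbounded_above.
  have cut m : m \in s -> exists k, forall B : {fset nat},
      (forall i, (i \in B) <-> L i /\ (i < k)%N) -> H m B.
    move=> ms; have [Mm am] := sZ _ ms.
    have [i [Mi ai]|B HB [k Bk]] := am L uL; first by split=> //; exact: ai.
    exists k => C Ck; suff -> : C = B by [].
    by apply/fsetP => i; apply/idP/idP => [/Ck/Bk|/Bk/Ck].
  have /choice[k kP] m : exists k, m \in s -> forall B : {fset nat},
      (forall i, (i \in B) <-> L i /\ (i < k)%N) -> H m B.
    by have [/cut[k kP]|] := pselect (m \in s); [exists k|exists 0].
  have /choice[B BP] := truncation L.
  have Bsub i j : (i <= j)%N -> (B i `<=` B j)%fset.
    move=> ij; apply/fsubsetP => l /BP[Ll li]; apply/BP; split=> //.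
    exact: leq_trans ij.
  have [ms [mss msmax]] : exists ms, ms \in s /\ forall m, m \in s -> (k m <= k ms)%N.
    have := @arg_maxnP s [` m0s]%fset predT (fun i => k (val i)) isT.
    case=> i _ imax; exists (val i); split; first exact: valP.
    by move=> m ms; exact: (imax [` ms]%fset).
  have [[t Et] _] := kP ms mss (B (k ms)) (BP _).
  exists t => m ms'; have [_] := kP m ms' (B (k m)) (BP _); apply.
  by apply: EB Et; apply: Bsub; exact: msmax.
exists (M `&` [set j | (n < j)%N]); split; [by move=> i [/MN]|exact: unbounded_gt|].
move=> m [Mm nm] C CM exC; apply: contrapT => nex.
have [nm'|am] := alt m Mm; last first.
  by have := Zn m (conj Mm am); rewrite ltnNge ltnW.
apply: (nm' C) => [i /CM[[? ?] ?]//|]; split=> // t [tp tC].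
by apply: contrapT => tm; apply: nex; exists t.
Qed.

(** The points of [P] outside [B] are deleted from the support one at a time, in increasing order.
    On reaching [n], the support meets [P] below [n] exactly in the part of [B] below [n];
    [removable], with these two parts as [p] and [q], drops [n] and keeps the rest of [B] in [G]. *)
Lemma monochromatic_subsets (G : T -> set nat) : (forall t, G t `<=` A t) ->
  forall N, unbounded N -> exists M, [/\ M `<=` N, unbounded M &
  forall t (P B : {fset nat}), [set` P] `<=` M -> (B `<=` P)%fset ->
    [set` B] `<=` G t ->
    exists t', A t' `&` [set` P] = [set` B] /\ [set` B] `<=` G t'].
Proof.
move=> GA N uN.
pose R (p q : {fset nat}) (M : set nat) := forall m, M m ->
    forall B : {fset nat}, [set` B] `<=` M `&` [set j | (m < j)%N] ->
    (exists t, A t `&` [set` p] = [set` q] /\ [set` (q `|` B)%fset] `<=` G t) ->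
    exists t, [/\ A t `&` [set` p] = [set` q], ~ A t m &
                  [set` (q `|` B)%fset] `<=` G t].
have Rsub (p q : {fset nat}) X Y : Y `<=` X -> R p q X -> R p q Y.
  by move=> YX RX m Ym B BY; apply: RX => [|i /BY[]]; [exact: YX|split=> //; exact: YX].
(* The fusion runs over [p], treating at each stage all the finitely many subsets [q] of [p]. *)
have [||M [MN uM MR]] := @fusion_fset (fun p X => forall q, q \in fpowerset p -> R p q X)
    _ _ N uN.
- by move=> p X Y YX RX q /RX; exact: Rsub.
- move=> p X uX; have [Y [YX uY RY]] := dense_all (fpowerset p)
    (Rsub p) (fun q X _ uX => removable G p q uX) uX.
  by exists Y; split=> // q qp; exact: RY.
exists M; split=> // t P B PM BP tB.
pose cut (C : {fset nat}) n := [fset i in C | (i < n)%N]%fset.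
have [b Pb] := fset_bound P.
suff [t' [tP tB']] : exists t', A t' `&` [set` cut P b] = [set` cut B b] /\ [set` B] `<=` G t'.
  have cutb (C : {fset nat}) : (C `<=` P)%fset -> cut C b = C.
    move=> CP; apply/fsetP => i; rewrite !inE/=.
    by case iC: (i \in C) => //=; apply: Pb; exact: (fsubsetP CP).
  by exists t'; split=> //; move: tP; rewrite !cutb.
elim: b {Pb} => [|n [t' [tP tB']]].
  have cut0 C : cut C 0 = fset0.
    by apply/fsetP => i; rewrite !inE /= andbF.
  by exists t; split=> //; rewrite !cut0; apply/seteqP; split=> [i []|i]//=; rewrite inE.
have cutS C : cut C n.+1 = if n \in C then (n |` cut C n)%fset else cut C n.
  apply/fsetP => i; case: ifP => nC; rewrite !inE/=; rewrite ltnS leq_eqVlt.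
    by have [->|] := eqVneq i n; rewrite ?nC.
  by have [->|] := eqVneq i n; rewrite ?nC.
have [nP|nP] := boolP (n \in P); last first.
  have nB : (n \in B) = false by apply/negP => /(fsubsetP BP); apply/negP.
  by exists t'; rewrite !cutS nB (negbTE nP).
have [nB|nB] := boolP (n \in B).
  (* Nothing changes here: [n] belongs to [B], hence to [G t'], hence to the support. *)
  exists t'; split=> //; rewrite !cutS nB nP.
  apply/seteqP; split=> [i /= [ti]|i /=]; rewrite !in_fset1U => /predU1P[->|].
  - by rewrite eqxx.
  - move=> iP; apply/orP; right.
    suff : (A t' `&` [set` cut P n]) i by rewrite tP.
    by [].
  - by split; [apply/GA/tB'|rewrite eqxx].
  - move=> iB; have : [set` cut B n] i by [].
    by rewrite -tP /= => -[? ->]; rewrite orbT.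
have cP : [set` cut P n] `<=` M by move=> i /=; rewrite !inE/= => /andP[/PM].
have cq : cut B n \in fpowerset (cut P n).
  rewrite fpowersetE; apply/fsubsetP => i; rewrite !inE/= => /andP[/(fsubsetP BP) -> ->] //.
pose C := [fset i in B | (n < i)%N]%fset.
have BE : (cut B n `|` C)%fset = B.
  apply/fsetP => i; rewrite !inE/= -andb_orr -neq_ltn.
  by have [->|] := eqVneq i n; rewrite ?andbT// (negbTE nB).
have [| | |t'' [tP'' tn tB'']] := MR _ cP _ cq n _ C.
- by split; [exact: PM|move=> i; rewrite !inE/= => /andP[]].
- move=> i /=; rewrite !inE/= => /andP[iB ni]; split=> //; split; first exact/PM/(fsubsetP BP).
  by move=> j; rewrite !inE/= => /andP[_ /ltn_trans]; apply.
- by exists t'; rewrite BE.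
exists t''; split; last by rewrite -BE.
rewrite !cutS (negbTE nB) nP -tP''; apply/seteqP; split=> [i /= [ti]|i /= [ti iP]].
  by rewrite in_fset1U => /predU1P[in_|//]; case: tn; rewrite -in_.
by split=> //; rewrite in_fset1U iP orbT.
Qed.

End unconditionality.

(** * Schreier families *)

Lemma fsmax_ge (s : {fset nat}) i : i \in s -> (i <= fsmax s)%N.
Proof. by move=> si; exact: (leq_bigmax_seq (F := id)). Qed.

Lemma fsmin_le (s : {fset nat}) i : i \in s -> (fsmin s <= i)%N.
Proof.
rewrite /fsmin => si; have : i \in enum_fset s by [].
elim: (enum_fset s) => // j r IH; rewrite big_cons inE geq_min => /predU1P[->|/IH->].
  by rewrite leqnn.
by rewrite orbT.
Qed.

Lemma fsmin_in (s : {fset nat}) : s != fset0 -> fsmin s \in s.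
Proof.
move=> /fset0Pn[i0 i0s]; have exs : exists i, i \in s by exists i0.
case: (ex_minnP exs) => m ms mmin.
suff -> : fsmin s = m by [].
apply/eqP; rewrite eqn_leq fsmin_le//= /fsmin big_seq.
elim/big_ind: _ => [|x y mx my|i si]; [exact: fsmax_ge|by rewrite leq_min mx|exact: mmin].
Qed.

Lemma fsmax_in (s : {fset nat}) : s != fset0 -> fsmax s \in s.
Proof.
elim/fset_ind_max: s => [|s m _ sm _]; first by rewrite eqxx.
suff -> : fsmax (m |` s)%fset = m by rewrite !inE eqxx.
apply/eqP; rewrite eqn_leq fsmax_ge ?inE ?eqxx// andbT /fsmax big_seq.
elim/big_ind: _ => // [x y mx my|i]; first by rewrite geq_max mx.
by rewrite !inE => /predU1P[->//|/sm/ltnW].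
Qed.

Lemma fset_lt_trans : transitive fset_lt.
Proof.
move=> F E G /leq_trans EF FG; apply: EF; apply: leq_trans (ltnW FG).
rewrite /fsmin; elim: (enum_fset F) => [|i r IH]; first by rewrite big_nil.
by rewrite big_cons geq_min IH orbT.
Qed.

Lemma fset_ltP E F : E != fset0 -> F != fset0 ->
  reflect (forall i j, i \in E -> j \in F -> (i < j)%N) (fset_lt E F).
Proof.
move=> E0 F0; apply: (iffP idP) => [EF i j /fsmax_ge iE /fsmin_le jF|EF].
  exact: leq_ltn_trans iE (leq_trans EF jF).
exact: EF (fsmax_in E0) (fsmin_in F0).
Qed.

Lemma mem_seq_bigfcup (Gs : seq {fset nat}) i :
  reflect (exists2 G, G \in Gs & i \in G) (i \in \bigcup_(G <- Gs) G)%fset.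
Proof.
by apply: (iffP (bigfcupP _ _ _ _)) => -[G]; rewrite ?andbT => GGs iG; exists G; rewrite ?GGs.
Qed.

Definition mins (Gs : seq {fset nat}) : {fset nat} := [fset i in map fsmin Gs]%fset.

Lemma mem_mins Gs i : (i \in mins Gs) = (i \in map fsmin Gs).
Proof. by rewrite in_fset. Qed.

Lemma card_mins_le Gs : (#|` mins Gs| <= size Gs)%N.
Proof.
rewrite -(size_map fsmin); apply: uniq_leq_size; first exact: fset_uniq.
by move=> i; rewrite mem_mins.
Qed.

(** The minima of successive nonempty pieces increase strictly, so a bound on the set of minima
    bounds the number of pieces. *)
Lemma card_mins_ge Gs : fset0 \notin Gs -> sorted fset_lt Gs ->
  (size Gs <= #|` mins Gs|)%N.
Proof.
move=> G0 sG; rewrite -(size_map fsmin); apply: uniq_leq_size; last first.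
  by move=> i; rewrite -mem_mins.
apply: (@sorted_uniq _ ltn); [exact: ltn_trans|exact: ltnn|].
rewrite sorted_map; apply: (@sub_in_sorted _ (mem Gs) fset_lt) sG => [E F EG FG /= EF|].
  by apply: leq_ltn_trans EF; apply/fsmax_ge/fsmin_in; apply: contraNneq G0 => <-.
exact/allP.
Qed.

Section schreier_closure.
Variable F : {fset nat} -> Prop.
Local Notation F' := (family_comp schreier1 F).

(* The number of pieces is bounded by min A + 1 (and not min A) because the
   Schreier families are indexed from zero. *)
Lemma family_comp_schreier1P A : F' A -> exists Gs : seq {fset nat},
  [/\ A = (\bigcup_(G <- Gs) G)%fset, fset0 \notin Gs, sorted fset_lt Gs,
      forall G, G \in Gs -> F G & (size Gs <= (fsmin A).+1)%N].
Proof.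
case=> [->|[Gs [-> G0 sG FG SG]]].
  by exists [::]; split=> //; rewrite big_nil.
exists Gs; split=> //; rewrite -/(mins Gs) in SG.
have [Gs0|/fset0Pn[i im]] := eqVneq (mins Gs) fset0.
  by apply: leq_trans (card_mins_ge G0 sG) _; rewrite Gs0 cardfs0.
case: SG => [SG|SG]; first by rewrite SG inE in im.
apply: leq_trans (card_mins_ge G0 sG) (leq_trans SG _); rewrite ltnS.
have /fsmin_in/mem_seq_bigfcup[G GGs mG] : (\bigcup_(G <- Gs) G)%fset != fset0.
  move: im; rewrite mem_mins => /mapP[G GGs _]; apply/fset0Pn; exists (fsmin G).
  apply/mem_seq_bigfcup; exists G => //; apply: fsmin_in.
  by apply: contraNneq G0 => <-.
apply: leq_trans (fsmin_le mG); apply: fsmin_le.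
by rewrite mem_mins; exact: map_f.
Qed.

(** Intersect the pieces of [A] with [B] and discard the empty ones: the number of pieces does not
    grow, while the least element can only increase. *)
Lemma hereditary_family_comp : hereditary F -> hereditary F'.
Proof.
move=> hF A B BA /family_comp_schreier1P[Gs [AE G0 sG FG nG]].
have [->|B0] := eqVneq B fset0; [by left|right].
pose Gs' := [seq G <- Gs | (G `&` B)%fset != fset0].
exists [seq (G `&` B)%fset | G <- Gs'].
have Gs'P G : G \in Gs' -> G \in Gs /\ (G `&` B)%fset != fset0.
  by rewrite mem_filter => /andP[].
split.
- apply/fsetP => i; apply/idP/mem_seq_bigfcup => [iB|[_ /mapP[G _ ->]]]; last first.
    by rewrite inE => /andP[].
  have := fsubsetP BA _ iB; rewrite AE => /mem_seq_bigfcup[G GGs iG].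
  exists (G `&` B)%fset; last by rewrite inE iG.
  by apply: map_f; rewrite mem_filter GGs andbT; apply/fset0Pn; exists i; rewrite inE iG.
- by apply/mapP => -[G /Gs'P[_ +] E]; rewrite -E eqxx.
- rewrite (sorted_pairwise fset_lt_trans) pairwise_map.
  have : pairwise fset_lt Gs'.
    by apply: pairwise_filter; rewrite -(sorted_pairwise fset_lt_trans).
  apply: (@sub_in_pairwise _ (mem Gs')); last exact/allP.
  move=> G H /Gs'P[GGs GB] /Gs'P[HGs HB] /= GH.
  have n0 K : K \in Gs -> K != fset0 by move=> KGs; apply: contraNneq G0 => <-.
  apply/fset_ltP => // i j; rewrite !inE => /andP[iG _] /andP[jH _].
  exact: (fset_ltP (n0 _ GGs) (n0 _ HGs) GH).
- move=> _ /mapP[G /Gs'P[GGs _] ->]; apply: hF (FG _ GGs); exact: fsubsetIl.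
- right; apply: leq_trans (card_mins_le _) _; rewrite size_map.
  apply: leq_trans (leq_trans nG _); first by rewrite size_filter count_size.
  rewrite ltnS -/(mins _).
  have : mins [seq (G `&` B)%fset | G <- Gs'] != fset0.
    have /fset0Pn[i iB] := B0.
    have := fsubsetP BA _ iB; rewrite AE => /mem_seq_bigfcup[G GGs iG].
    apply/fset0Pn; exists (fsmin (G `&` B)%fset); rewrite mem_mins; do 2 apply: map_f.
    by rewrite mem_filter GGs andbT; apply/fset0Pn; exists i; rewrite inE iG.
  move=> /fsmin_in; rewrite {1}mem_mins => /mapP[_ /mapP[G /Gs'P[_ /fsmin_in GB] ->] ->].
  by apply/fsmin_le/(fsubsetP BA); move: GB; rewrite inE => /andP[].
Qed.

Lemma family_comp_self A : F A -> F' A.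
Proof.
move=> FA; have [->|A0] := eqVneq A fset0; [by left|right].
exists [:: A]; split=> //; first by rewrite big_seq1.
- by rewrite inE eq_sym.
- by move=> G; rewrite inE => /eqP ->.
- by right; apply: leq_trans (card_mins_le _) _.
Qed.

(** The singleton and [A] make two pieces. With indices starting at zero, two pieces are allowed as
    soon as the least element is at least 1. *)
Lemma family_comp_cons m A : (0 < m)%N -> F [fset m]%fset -> F A ->
  (forall i, i \in A -> (m < i)%N) -> F' (m |` A)%fset.
Proof.
move=> m0 Fm FA mA; have [->|A0] := eqVneq A fset0.
  by rewrite fsetU0; exact: family_comp_self.
right; exists [:: [fset m]%fset; A]; split.
- by rewrite big_cons big_seq1.
- by rewrite !inE !(eq_sym fset0) negb_or fset1_neq0.
- rewrite /= andbT; apply/fset_ltP => //; first exact: fset1_neq0.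
  by move=> i j; rewrite inE => /eqP -> /mA.
- by move=> G; rewrite !inE => /orP[/eqP ->|/eqP ->].
- right; apply: leq_trans (card_mins_le _) _; rewrite ltnS -/(mins _).
  have : mins [:: [fset m]%fset; A] != fset0.
    by apply/fset0Pn; exists m; rewrite mem_mins /= fsmin1 inE eqxx.
  move=> /fsmin_in; rewrite {1}mem_mins !inE fsmin1 => /orP[/eqP ->//|/eqP ->].
  exact: leq_trans m0 (ltnW (mA _ (fsmin_in A0))).
Qed.

End schreier_closure.

(** The pieces may overlap and come in any order: for norm estimates only their number counts. *)
Definition kfold (F : {fset nat} -> Prop) (k : nat) (A : {fset nat}) :=
  exists Gs : seq {fset nat}, [/\ A = (\bigcup_(G <- Gs) G)%fset,
    (size Gs <= k)%N & forall G, G \in Gs -> F G].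

Lemma hereditary_kfold F k : hereditary F -> hereditary (kfold F k).
Proof.
move=> hF A B BA [Gs [AE nG FG]].
exists [seq (G `&` B)%fset | G <- Gs]; split; last 2 first.
- by rewrite size_map.
- by move=> _ /mapP[G /FG FG' ->]; apply: hF FG'; exact: fsubsetIl.
apply/fsetP => i; apply/idP/mem_seq_bigfcup => [iB|[_ /mapP[G _ ->]]]; last first.
  by rewrite inE => /andP[].
have := fsubsetP BA _ iB; rewrite AE => /mem_seq_bigfcup[G GGs iG].
by exists (G `&` B)%fset; [exact: map_f|rewrite inE iG].
Qed.

Lemma kfold1 (F : {fset nat} -> Prop) A : F A -> kfold F 1 A.
Proof.
by move=> FA; exists [:: A]; split=> // [|G]; [rewrite big_seq1|rewrite inE => /eqP->].
Qed.

Lemma omega1_ind (P : omega1 -> Prop) :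
  (forall a, (forall b, (b < a)%O -> P b) -> P a) -> forall a, P a.
Proof.
move=> IH a; apply: contrapT => nPa.
have [|b nPb bmin] := omega1_min (A := [set b | ~ P b]); first by exists a.
apply: nPb; apply: IH => c cb; apply: contrapT => /bmin.
by rewrite leNgt cb.
Qed.

(** Otherwise countably many countable initial segments would exhaust [omega1]. *)
Lemma omega1_seq_bounded (u : nat -> omega1) : exists b, forall n, (u n <= b)%O.
Proof.
apply: contrapT => /forallNP nb; apply: omega1_uncountable.
apply: (@sub_countable _ _ _ (\bigcup_n [set b | (b <= u n)%O])); last first.
  by apply: bigcup_countable => // n _; exact: omega1_countable.
apply: subset_card_le => b _; have /existsNP[n /negP] := nb b.
by rewrite -ltNge => /ltW; exists n.
Qed.

Lemma omega1_cases (a : omega1) :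
  [\/ is_zero a, exists b, a = osucc b | is_limit a].
Proof.
have [a0|na0] := pselect (is_zero a); first by constructor 1.
have [ab|nab] := pselect (exists b, a = osucc b); first by constructor 2.
by constructor 3; split=> // b ab; apply: nab; exists b.
Qed.

Lemma lt_osucc (a b : omega1) : (a < osucc b)%O = (a <= b)%O.
Proof.
apply/idP/idP => [|ab]; last exact: le_lt_trans ab (osuccP b).1.
by rewrite !leNgt; apply: contraTN => /(osuccP b).2; rewrite leNgt.
Qed.

Section schreier_ordinals.
Variable alpha : fundamental_system.
Local Notation S := (schreier alpha).

Lemma fseq_lt_limit a n : is_limit a -> (osucc (alpha a n) < a)%O.
Proof.
move=> la; have [ub _] := fseq_limit_cvg alpha la.
apply: lt_le_trans (_ : osucc (alpha a n.+1) <= a)%O; last by apply: ub; exists n.+1.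
exact: (fseq_limit_incr alpha la).
Qed.

Lemma fseq_limit_gt a b : is_limit a -> (b < a)%O ->
  exists n, (b < osucc (alpha a n))%O.
Proof.
move=> la ba; apply: contrapT => /forallNP nb.
have [_ lub] := fseq_limit_cvg alpha la.
suff : (a <= b)%O by rewrite leNgt ba.
by apply: lub => _ [n _ <-]; rewrite leNgt; apply/negP.
Qed.

Lemma hereditary_schreier xi : hereditary (S xi).
Proof.
elim/omega1_ind: xi => xi IH.
have [xi0|[zeta xiE]|xil] := omega1_cases xi.
- rewrite schreier_zeroE// => A B BA [A0|[i Ai]].
    by left; move: BA; rewrite A0 fsubset0 => /eqP.
  by move: BA; rewrite Ai fsubset1 => /orP[/eqP ->|/eqP ->]; [right; exists i|left].
- rewrite xiE schreier_succE; apply: hereditary_family_comp; apply: IH.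
  by rewrite xiE lt_osucc.
- rewrite schreier_limitE// => A B BA [A0|[n [SA nA]]].
    by left; move: BA; rewrite A0 fsubset0 => /eqP.
  have [->|B0] := eqVneq B fset0; [by left|right].
  exists n; split; first by apply: IH SA => //; exact: fseq_lt_limit.
  exact: leq_trans nA (fsmin_le (fsubsetP BA _ (fsmin_in B0))).
Qed.

Lemma schreier_set0 xi : S xi fset0.
Proof. exact: (hereditary_schreier (fsub0set _) (schreier_set1 alpha xi 0)). Qed.

Lemma schreier_limit_fseq xi n A : is_limit xi -> S (osucc (alpha xi n)) A ->
  (forall i, i \in A -> (n <= i)%N) -> S xi A.
Proof.
move=> xil SA nA; rewrite schreier_limitE//.
by have [->|/fsmin_in/nA nm] := eqVneq A fset0; [left|right; exists n].
Qed.

(** * Comparing a compact hereditary family with the Schreier families *)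

Section embedding.
Variable F : {fset nat} -> Prop.
Hypothesis F_hereditary : hereditary F.
Hypothesis F_compact : forall Z, unbounded Z ->
  ~ (forall s : {fset nat}, [set` s] `<=` Z -> F s).

(** A substitute for the statement that [s] has rank at least [xi] in the tree [F]. The infinite set
    may vary with [xi] and [s], which absorbs the tails lost at limit ordinals. *)
Let D xi (s : {fset nat}) := exists2 M, unbounded M & forall T : {fset nat},
  [set` T] `<=` M `&` above s -> S xi T -> F (s `|` T)%fset.

(** Induction on [xi]. At the successor of [eta], a point followed by a member of [S eta] is in
    [S xi], so a point of [M] beyond [s] can be moved into [s]; a smaller [zeta] is reached through
    [eta]. At a limit, go down to some [osucc (alpha xi n)] above [zeta], keeping only points beyond
    [n]. *)
Let D_step xi s zeta : D xi s -> (zeta < xi)%O ->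
  exists2 m, above s m & D zeta (m |` s)%fset.
Proof.
elim/omega1_ind: xi => xi IH [M uM DM].
have [xi0|[eta xiE]|xil] := omega1_cases xi.
- by rewrite ltNge xi0.
- rewrite xiE lt_osucc le_eqVlt => /predU1P[->|ze]; last first.
    apply: (IH eta) => //; first by rewrite xiE lt_osucc.
    exists M => // T TM ST; apply: DM => //.
    by rewrite xiE schreier_succE; exact: family_comp_self.
  have [m [Mm sm] m0] := unbounded_above s uM 1.
  exists m => //; exists M => // T TM ST.
  rewrite (fsetUC [fset m]%fset) -fsetUA; apply: DM.
    move=> i /=; rewrite in_fset1U => /predU1P[->//|/TM[Mi ai]].
    by split=> // j sj; apply: ai; rewrite in_fset1U sj orbT.
  rewrite xiE schreier_succE; apply: family_comp_cons => //.
    exact: schreier_set1.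
  by move=> i /TM[_ ai]; apply: ai; rewrite !inE eqxx.
- move=> zx; have [n zn] := fseq_limit_gt xil zx.
  apply: (IH (osucc (alpha xi n))) => //; first exact: fseq_lt_limit.
  exists (M `&` [set j | (n < j)%N]); first exact: unbounded_gt.
  move=> T TM ST; apply: DM; first by move=> i /TM[[Mi _] ai].
  by apply: schreier_limit_fseq ST _ => // i /TM[[_ /ltnW]].
Qed.

Let D_self xi s : D xi s -> F s.
Proof.
move=> [M uM DM]; have := DM fset0; rewrite fsetU0; apply; last exact: schreier_set0.
by move=> i /=; rewrite inE.
Qed.

(* By regularity of omega_1, if s has unboundedly large rank in F then so does
   one of its one-point end-extensions. *)
Lemma schreier_not_embedded : exists xi, ~ exists2 M, unbounded M &
  forall A : {fset nat}, [set` A] `<=` M -> S xi A -> F A.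
Proof.
apply: contrapT => /forallNP emb.
pose U s := forall zeta, exists2 xi, (zeta <= xi)%O & D xi s.
have U0 : U fset0.
  move=> zeta; have /contrapT[M uM MF] := emb zeta; exists zeta => //.
  by exists M => // T TM; rewrite fset0U; apply: MF => i /TM[].
have [z0 _] : exists z : omega1, True.
  apply: contrapT => /forallNP no; apply: omega1_uncountable.
  by apply: (@sub_countable _ _ _ set0) => //; apply: subset_card_le => z _; exact: (no z).
have US s : U s -> exists2 m, above s m & U (m |` s)%fset.
  move=> Us; apply: contrapT => nU.
  (* If no one-point end-extension satisfied [U], each [m] would have a threshold [z m]; above a
     common bound [b] of the thresholds, [D_step] still produces an extension. *)
  have /choice[z zP] m : exists z, above s m ->
      forall xi, (z <= xi)%O -> ~ D xi (m |` s)%fset.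
    have [sm|nsm] := pselect (above s m); last by exists z0.
    have /existsNP[z nz] : ~ U (m |` s)%fset by move=> Um; apply: nU; exists m.
    by exists z => _ xi zxi Dxi; apply: nz; exists xi.
  have [b zb] := omega1_seq_bounded z.
  have [xi bxi Dxi] := Us (osucc b).
  have [m sm Dm] := D_step Dxi (lt_le_trans (osuccP b).1 bxi).
  exact: (zP m sm b (zb m) Dm).
have /choice[g gP] s : exists m, U s -> above s m /\ U (m |` s)%fset.
  have [/US[m sm Um]|nU] := pselect (U s); last by exists 0.
  by exists m.
pose s n := iter n (fun s => (g s |` s)%fset) fset0.
have Usn n : U (s n) by elim: n => //= n /gP[].
have sS n : above (s n) (g (s n)) by have [] := gP _ (Usn n).
have sle m n : (m <= n)%N -> (s m `<=` s n)%fset.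
  move=> /subnK <-; elim: (n - m)%N => [|d IH]; first exact: fsubset_refl.
  by rewrite addSn /=; apply: fsubset_trans IH _; exact: fsubsetUr.
have gs m n : (m < n)%N -> g (s m) \in s n.
  by move=> /sle/fsubsetP; apply; rewrite /= !inE eqxx.
have gge n : (n <= g (s n))%N.
  by elim: n => // n /leq_ltn_trans; apply; apply: (sS n.+1); exact: gs.
apply: (@F_compact (range (g \o s))) => [n|A AZ].
  by exists (g (s n)) => //; exists n.
have [b Ab] := fset_bound A.
have [xi _ /D_self] := Usn b z0; apply: F_hereditary.
apply/fsubsetP => i iA; have [n _ ni] := AZ _ iA; rewrite -ni; apply: gs.
by apply: leq_ltn_trans (gge n) _; rewrite [X in (X < _)%N]ni; exact: Ab.
Qed.

(** The least element of [A] is removed because it tells the diagonal argument where the rest of [A]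
    lies: for a successor [xi] it bounds the number of pieces, for a limit [xi] it bounds the index
    in the fundamental sequence. Either way the rest is controlled by ordinals below [xi], to which
    minimality applies. *)
Lemma schreier_approximation N : (forall i, F [fset i]%fset) -> unbounded N ->
  exists (xi : omega1) (k : nat) (M : set nat),
  [/\ M `<=` N, unbounded M,
      forall A : {fset nat}, [set` A] `<=` M -> F A -> kfold (S xi) k A
    & forall A : {fset nat}, [set` A] `<=` M -> S xi A -> F (A `\ fsmin A)%fset].
Proof.
move=> F1 uN.
have F0 : F fset0 by exact: F_hereditary (fsub0set _) (F1 0).
pose covers xi := exists k M, [/\ M `<=` N, unbounded M &
  forall A : {fset nat}, [set` A] `<=` M -> F A -> kfold (S xi) k A].
(* For an ordinal that does not cover, only the second alternative of the dichotomy can occur. *)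
have ncovers xi k X : ~ covers xi -> X `<=` N -> unbounded X ->
    exists Y, [/\ Y `<=` X, unbounded Y &
      forall A : {fset nat}, [set` A] `<=` Y -> kfold (S xi) k A -> F A].
  move=> nc XN uX.
  have hS : hereditary (kfold (S xi) k) by apply: hereditary_kfold; exact: hereditary_schreier.
  have [Y [YX uY [FY|YF]]] := family_dichotomy F_hereditary hS uX; last by exists Y.
  by case: nc; exists k, Y; split=> //; exact: subset_trans XN.
have [|xi [k [M [MN uM FM]]] ximin] := omega1_min (A := covers).
  have [xi nxi] := schreier_not_embedded; exists xi; apply: contrapT => nc.
  have [Y [_ uY YF]] := ncovers xi 1 N nc (@subset_refl _ _) uN.
  by apply: nxi; exists Y => // A AY /kfold1; exact: YF.
have {}ximin zeta : (zeta < xi)%O -> ~ covers zeta.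
  by move=> zx /ximin; rewrite leNgt zx.
exists xi, k.
suff [M' [M'M uM' FM']] : exists M', [/\ M' `<=` M, unbounded M' &
    forall A : {fset nat}, A != fset0 -> [set` A] `<=` M' -> S xi A ->
    F (A `\ fsmin A)%fset].
  exists M'; split=> //; first exact: subset_trans MN.
    by move=> A AM; apply: FM; exact: subset_trans M'M.
  move=> A AM SA; have [->|A0] := eqVneq A fset0; last exact: FM'.
  by apply: F_hereditary F0; rewrite fsubset0 fset0D.
(* It is enough to find a property of the remaining set, depending on the removed minimum [m], that
   forces membership in [F] on some infinite subset. *)
have fuse (Q : nat -> {fset nat} -> Prop) :
    (forall m X, X `<=` M -> unbounded X -> exists Y, [/\ Y `<=` X, unbounded Y &
      forall A : {fset nat}, [set` A] `<=` Y -> Q m A -> F A]) ->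
    (forall A, A != fset0 -> S xi A -> Q (fsmin A) (A `\ fsmin A)%fset) ->
    exists M', [/\ M' `<=` M, unbounded M' &
    forall A : {fset nat}, A != fset0 -> [set` A] `<=` M' -> S xi A ->
    F (A `\ fsmin A)%fset].
  move=> Qdense SQ.
  have [||M' [M'M uM' FM']] := @fusion (fun m X =>
      forall A : {fset nat}, [set` A] `<=` X -> Q m A -> F A) M _ _ uM.
  - by move=> m X Y YX QX A AY; apply: QX; exact: subset_trans YX.
  - exact: Qdense.
  exists M'; split=> // A A0 AM' SA; apply: (FM' (fsmin A)) (SQ A A0 SA).
    exact/AM'/fsmin_in.
  move=> i /=; rewrite !inE => /andP[im iA]; split; first exact: AM'.
  by rewrite /= ltn_neqAle eq_sym im fsmin_le.
have [xi0|[zeta xiE]|xil] := omega1_cases xi.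
- exists M; split=> // A A0 _; rewrite schreier_zeroE// => -[E|[i ->]].
    by rewrite E eqxx in A0.
  by rewrite fsmin1 fsetDv.
(* With least element [m], a member of [S xi] has at most [m.+1] pieces from [S zeta]. *)
- apply: (fuse (fun m A => kfold (S zeta) m.+1 A)) => [m X XM uX|A A0 SA].
    apply: ncovers => //; last exact: subset_trans MN.
    by apply: ximin; rewrite xiE lt_osucc.
  have hS := hereditary_schreier (xi := zeta).
  apply: (hereditary_kfold hS) (_ : kfold (S zeta) (fsmin A).+1 A); first exact: fsubD1set.
  move: SA; rewrite xiE schreier_succE => /family_comp_schreier1P[Gs [AE _ _ GS nG]].
  by exists Gs.
(* Only the indices n from 0 to [m] can occur, and [dense_all] deals with these finitely many
   ordinals. *)
- apply: (fuse (fun m A => exists2 n, (n <= m)%N & S (osucc (alpha xi n)) A)).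
    move=> m X XM uX.
    have [||Y [YX uY YF]] := @dense_all _ (fun n Y => forall A : {fset nat},
      [set` A] `<=` Y -> S (osucc (alpha xi n)) A -> F A) X (iota 0 m.+1) _ _ uX.
    - by move=> n U V VU FU A AV; apply: FU; exact: subset_trans VU.
    - move=> n U UX uU.
      have nc : ~ covers (osucc (alpha xi n)) by apply: ximin; exact: fseq_lt_limit.
      have [|Y [YU uY YF]] := ncovers _ 1 U nc _ uU.
        exact: subset_trans UX (subset_trans XM MN).
      by exists Y; split=> // A AY /kfold1; exact: YF.
    exists Y; split=> // A AY [n nm]; apply: YF => //.
    by rewrite mem_iota.
  move=> A A0; rewrite schreier_limitE// => -[E|[n [SA nA]]].
    by rewrite E eqxx in A0.
  exists n => //; apply: hereditary_schreier SA; exact: fsubD1set.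
Qed.

End embedding.
End schreier_ordinals.

(** * Equivalence of sequences *)

Local Open Scope ring_scope.

Lemma sum_scale_widen (KK : numFieldType) (V : normedModType KK) (x : nat -> V)
    (c : nat -> KK) n m : (n <= m)%N ->
  \sum_(i < n) c i *: x i = \sum_(i < m) (if (i < n)%N then c i else 0) *: x i.
Proof.
move=> nm; rewrite (big_ord_widen m (fun i => c i *: x i) nm) big_mkcond/=.
by apply: eq_bigr => i _; case: ifP => //; rewrite scale0r.
Qed.

(* The closure of the graph of x_n |-> y_n; unlike a map given by limits, it is
   symmetric in (x, y). *)
Definition span_graph (KK : numFieldType) (V W : normedModType KK)
    (x : nat -> V) (y : nat -> W) (v : V) (w : W) :=
  forall e : KK, 0 < e -> exists (n : nat) (c : nat -> KK),
    `|v - \sum_(i < n) c i *: x i| <= e /\ `|w - \sum_(i < n) c i *: y i| <= e.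

Section span_graph.
Variables (KK : numFieldType) (V W : normedModType KK).
Variables (x : nat -> V) (y : nat -> W).

Lemma span_graph_sym v w : span_graph x y v w -> span_graph y x w v.
Proof. by move=> g e /g[n [c [? ?]]]; exists n, c. Qed.

Lemma span_graph_closed v w : span_graph x y v w -> closed_span x v.
Proof.
move=> g B /nbhs_ballP[e /= e0 eB].
have [|n [c [vc _]]] := g (e / 2); first by rewrite divr_gt0.
exists (\sum_(i < n) c i *: x i); split; first by exists n, c.
apply: eB; rewrite -ball_normE /=; apply: le_lt_trans vc _.
by rewrite ltr_pdivrMr// mulr2n mulrDr mulr1 ltrDl.
Qed.

Lemma span_graph_basis n : span_graph x y (x n) (y n).
Proof.
move=> e e0; exists n.+1, (fun i => (i == n)%:R).
suff E (U : normedModType KK) (z : nat -> U) :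
    \sum_(i < n.+1) ((i : nat) == n)%:R *: z i = z n.
  by rewrite !E !subrr !normr0 ltW.
rewrite big_ord_recr/= eqxx scale1r big1 ?add0r// => i _.
by rewrite ltn_eqF// scale0r.
Qed.

Lemma span_graph_linear a v w v' w' : span_graph x y v w -> span_graph x y v' w' ->
  span_graph x y (a *: v + v') (a *: w + w').
Proof.
move=> g g' e e0; have a0 : 0 < `|a| + 1 by rewrite ltr_wpDl.
have d0 : 0 < e / (`|a| + 1) by rewrite divr_gt0.
have [n [c [vc wc]]] := g _ d0; have [n' [c' [vc' wc']]] := g' _ d0.
pose m := maxn n n'.
pose b i := a * (if (i < n)%N then c i else 0) + (if (i < n')%N then c' i else 0).
exists m, b.
have E (U : normedModType KK) (z : nat -> U) u u' :
    `|u - \sum_(i < n) c i *: z i| <= e / (`|a| + 1) ->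
    `|u' - \sum_(i < n') c' i *: z i| <= e / (`|a| + 1) ->
    `|a *: u + u' - \sum_(i < m) b i *: z i| <= e.
  rewrite (sum_scale_widen _ _ (leq_maxl n n')) (sum_scale_widen _ _ (leq_maxr n n')).
  move=> uc uc'.
  rewrite (_ : \sum_(i < m) b i *: z i =
    a *: (\sum_(i < m) (if (i < n)%N then c i else 0) *: z i) +
    \sum_(i < m) (if (i < n')%N then c' i else 0) *: z i); last first.
    rewrite scaler_sumr -big_split/=; apply: eq_bigr => i _.
    by rewrite scalerDl scalerA.
  rewrite opprD addrACA -scalerBr; apply: le_trans (ler_normD _ _) _.
  rewrite normrZ; apply: (@le_trans _ _ ((`|a| + 1) * (e / (`|a| + 1)))); last first.
    by rewrite mulrCA divff ?mulr1// gt_eqF.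
  by rewrite mulrDl mul1r lerD// ler_wpM2l.
by split; exact: E.
Qed.

Variable C : KK.
Hypothesis C0 : 0 <= C.
Hypothesis yx : forall n (c : nat -> KK),
  `|\sum_(i < n) c i *: y i| <= C * `|\sum_(i < n) c i *: x i|.

Lemma span_graph_bound v w : span_graph x y v w -> `|w| <= C * `|v|.
Proof.
move=> g; apply/ler_addgt0Pr => e e0.
(* Dividing by [C + 1] is safe even when [C] is zero. *)
have C1 : 0 < C + 1 by rewrite ltr_wpDl.
have [|n [c [vc wc]]] := g (e / (C + 1)); first by rewrite divr_gt0.
rewrite -(subrK (\sum_(i < n) c i *: y i) w); apply: le_trans (ler_normD _ _) _.
apply: (@le_trans _ _ (e / (C + 1) + C * (`|v| + e / (C + 1)))).
  apply: lerD => //; apply: le_trans (yx _ _) _; apply: ler_wpM2l => //.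
  rewrite -[X in `|X|](subKr v) (le_trans (ler_normB _ _))// lerD//.
rewrite mulrDr addrCA lerD2l -{1}[e / _]mul1r -mulrDl addrC mulrCA.
by rewrite divff ?mulr1// gt_eqF.
Qed.

Hypothesis W_complete : forall G : set_system W, ProperFilter G -> cauchy G -> cvg G.

Lemma lin_span_lipschitz n n' (c c' : nat -> KK) :
  `|\sum_(i < n) c i *: y i - \sum_(i < n') c' i *: y i| <=
  C * `|\sum_(i < n) c i *: x i - \sum_(i < n') c' i *: x i|.
Proof.
have E (U : normedModType KK) (z : nat -> U) :
    \sum_(i < n) c i *: z i - \sum_(i < n') c' i *: z i =
    \sum_(i < maxn n n') ((if (i < n)%N then c i else 0) -
                          (if (i < n')%N then c' i else 0)) *: z i.
  rewrite (sum_scale_widen _ _ (leq_maxl n n')) (sum_scale_widen _ _ (leq_maxr n n')).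
  by rewrite -sumrB; apply: eq_bigr => i _; rewrite scalerBl.
rewrite !E.
exact: (yx _ (fun i => (if (i < n)%N then c i else 0) - (if (i < n')%N then c' i else 0))).
Qed.

(** Combinations of [x] close to [v] are close to each other; by the Lipschitz bound the same
    combinations of [y] generate a Cauchy filter, whose limit is the image of [v]. *)
Lemma span_graph_total v : closed_span x v -> exists w, span_graph x y v w.
Proof.
move=> xv.
pose B (e : KK) := [set w | exists n (c : nat -> KK),
  w = \sum_(i < n) c i *: y i /\ `|v - \sum_(i < n) c i *: x i| < e].
pose G := filter_from [set e : KK | 0 < e] B.
have B_nonempty e : 0 < e -> B e !=set0.
  move=> e0; have [|s [[n [c ->]] vs]] := xv (ball v e); first exact: nbhsx_ballx.
  by exists (\sum_(i < n) c i *: y i), n, c; split=> //; move: vs; rewrite -ball_normE.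
have Ble e d : e <= d -> B e `<=` B d.
  by move=> ed w [n [c [-> vc]]]; exists n, c; split=> //; exact: lt_le_trans ed.
have FG : ProperFilter G.
  apply: filter_from_proper => //; apply: filter_from_filter; first by exists 1 => /=.
  (* Positive scalars are real and therefore comparable, even when the field is only partially
     ordered. *)
  move=> e d e0 d0; have [ed|de] := real_leP (gtr0_real e0) (gtr0_real d0).
    by exists e => // w Bw; split=> //; exact: Ble Bw.
  by exists d => // w Bw; split=> //; exact: Ble (ltW de) _ Bw.
have C1 : 0 < C + 1 by rewrite ltr_wpDl.
have cG : cvg G.
  apply: W_complete; apply/cauchyP => e e0.
  have d0 : 0 < e / 2 / (C + 1) by rewrite !divr_gt0.
  have [w0 [n [c [w0E vc]]]] := B_nonempty _ d0.
  exists w0; exists (e / 2 / (C + 1)) => // _ [n' [c' [-> vc']]].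
  rewrite -ball_normE /= w0E; apply: le_lt_trans (lin_span_lipschitz _ _ _ _) _.
  have : `|\sum_(i < n) c i *: x i - \sum_(i < n') c' i *: x i| < e / (C + 1).
    rewrite -(subrK v (\sum_(i < n) _)) -addrA; apply: le_lt_trans (ler_normD _ _) _.
    by rewrite (splitr e) mulrDl distrC ltrD.
  rewrite ltr_pdivlMr// => /(le_lt_trans _); apply; rewrite mulrC.
  by rewrite ler_wpM2l// lerDl.
exists (lim G) => e e0.
have [d d0 Bd] := cG _ (nbhsx_ballx (lim G) e e0).
have [m0 m1 m2] : exists2 m : KK, 0 < m & m <= e /\ m <= d.
  have [ed|/ltW de] := real_leP (gtr0_real e0) (gtr0_real d0); [exists e|exists d] => //.
have [w0 /[dup] Bw0 [n [c [w0E vc]]]] := B_nonempty _ m1.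
exists n, c; split; first by apply: le_trans (ltW vc) _; case: m2.
have /Bd : B d w0 by apply: Ble Bw0; case: m2.
by rewrite -ball_normE /= w0E => /ltW.
Qed.

End span_graph.

(** The two estimates make the closed graph relation total and single-valued in both directions. It
    thus defines [T] on one closed span and, read backwards, its inverse [U] on the other; outside
    these spans both take the default value 0. *)
Lemma equivalent_of_norms (KK : numFieldType) (V W : normedModType KK)
    (x : nat -> V) (y : nat -> W) (C D : KK) :
  (forall G : set_system V, ProperFilter G -> cauchy G -> cvg G) ->
  (forall G : set_system W, ProperFilter G -> cauchy G -> cvg G) ->
  0 <= C -> 0 <= D ->
  (forall n (c : nat -> KK),
    `|\sum_(i < n) c i *: y i| <= C * `|\sum_(i < n) c i *: x i|) ->
  (forall n (c : nat -> KK),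
    `|\sum_(i < n) c i *: x i| <= D * `|\sum_(i < n) c i *: y i|) ->
  equivalent x y.
Proof.
move=> cV cW C0 D0 yx xy.
pose T v := xget 0 (span_graph x y v); pose U w := xget 0 (span_graph y x w).
have TP v : closed_span x v -> span_graph x y v (T v).
  by move=> /(span_graph_total C0 yx cW)[w vw]; apply: (@xgetPex _ 0); exists w.
have UP w : closed_span y w -> span_graph y x w (U w).
  by move=> /(span_graph_total D0 xy cV)[v wv]; apply: (@xgetPex _ 0); exists v.
have diff (V' W' : normedModType KK) (x' : nat -> V') (y' : nat -> W') v w v' w' :
    span_graph x' y' v w -> span_graph x' y' v' w' ->
    span_graph x' y' (v - v') (w - w').
  by move=> g g'; have := span_graph_linear (-1) g' g; rewrite !scaleN1r ![- _ + _]addrC.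
have uniq_ v w w' : span_graph x y v w -> span_graph x y v w' -> w = w'.
  move=> g g'; apply/eqP; rewrite -subr_eq0 -normr_le0.
  have := span_graph_bound C0 yx (diff _ _ _ _ _ _ _ _ g g').
  by rewrite subrr normr0 mulr0.
have uniqV v v' w : span_graph x y v w -> span_graph x y v' w -> v = v'.
  move=> g g'; apply/eqP; rewrite -subr_eq0 -normr_le0.
  have := span_graph_bound D0 xy (span_graph_sym (diff _ _ _ _ _ _ _ _ g g')).
  by rewrite subrr normr0 mulr0.
have lip (V' W' : normedModType KK) (A : set V') (h : V' -> W') (E : KK) : 0 <= E ->
    (forall u v, A u -> A v -> `|h u - h v| <= E * `|u - v|) ->
    {within A, continuous h}.
  move=> E0 hl; apply/subspace_continuousP => u Au; apply/cvgrPdist_le => e e0.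
  have E1 : 0 < E + 1 by rewrite ltr_wpDl.
  near=> v.
  have Av : A v by near: v; exact: withinT.
  apply: le_trans (hl _ _ Au Av) _.
  apply: (@le_trans _ _ ((E + 1) * (e / (E + 1)))); last first.
    by rewrite mulrCA divff ?mulr1// gt_eqF.
  apply: ler_pM => //; first by rewrite lerDl.
  near: v; apply: cvg_within; apply/nbhs_ballP; exists (e / (E + 1)) => /=.
    by rewrite divr_gt0.
  by move=> v; rewrite -ball_normE /= => /ltW.
exists T, U; split.
- move=> a u v xu xv; apply: uniq_ (TP _ _) (span_graph_linear a (TP _ xu) (TP _ xv)).
  exact: span_graph_closed (span_graph_linear a (TP _ xu) (TP _ xv)).
- split; last first.
    move=> v; rewrite inE => xv; have g := TP _ xv.
    apply: uniqV (g); apply: span_graph_sym; apply: UP.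
    exact: span_graph_closed (span_graph_sym g).
  split.
  + by move=> v xv; exact: span_graph_closed (span_graph_sym (TP _ xv)).
  + move=> v v'; rewrite !inE => xv xv' Tvv'.
    by apply: uniqV (TP _ xv) _; rewrite Tvv'; exact: TP.
  + move=> w yw; have g := span_graph_sym (UP _ yw).
    exists (U w); first exact: span_graph_closed g.
    apply: uniq_ (TP _ _) (g); exact: span_graph_closed g.
- apply: (lip _ _ _ _ C) => // u v xu xv.
  exact: (span_graph_bound C0 yx (diff _ _ _ _ _ _ _ _ (TP _ xu) (TP _ xv))).
- apply: (lip _ _ _ _ D) => // u v yu yv.
  exact: (span_graph_bound D0 xy (diff _ _ _ _ _ _ _ _ (UP _ yu) (UP _ yv))).
- move=> n; apply: uniq_ (span_graph_basis x y n); apply: TP.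
  exact: span_graph_closed (span_graph_basis x y n).
Unshelve. all: by end_near. Qed.

(** * The space C(K) *)

Section Cspace_theory.
Variables (R : realType) (k : scalar_kind) (K : topologicalType).
Variable compactK : compact [set: K].
Local Notation KK := (scalar_field R k).
Local Notation C := (Cspace R k compactK).

Lemma Cspace_continuous (f : C) : continuous f.
Proof. by have /asboolP := Cspace_funP f. Qed.

(** The local bound [|f t| + 1] near t becomes global by the near-covering form of compactness. *)
Lemma Cspace_bounded (f : C) : has_ubound [set `|f t| | t in [set: K]].
Proof.
have fM : \forall M \near +oo, forall t, [set: K] t -> `|f t| <= M.
  apply: (iffLR (compact_near_coveringP _) compactK) => t _.
  have ft : \forall u \near t, `|f t| - `|f u| >= - 1.
    have /cvgrPdist_le/(_ 1 ltr01) := Cspace_continuous (f := f) (x := t).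
    apply: filterS => u ftu; rewrite -lerN2 opprB opprK.
    by apply: le_trans (lerB_dist _ _) _; rewrite distrC.
  have tM : \forall M \near +oo, `|f t| + 1 <= M.
    by apply: nbhs_pinfty_ge; rewrite realD// normr_real.
  exists ([set u | `|f t| - `|f u| >= - 1], [set M | `|f t| + 1 <= M]) => // -[u M] [] /= fu.
  by apply: le_trans; rewrite -lerBlDl -lerN2 opprB.
have [M {}fM] := filter_ex fM.
by exists M => _ [t _ <-]; exact: fM.
Qed.

Lemma Cspace_norm_ge (f : C) t : `|f t| <= `|f|.
Proof.
apply: (le_sup_seminorm (D := [set: K]) (p := fun t (f : C) => `|f t|)) => //.
exact: Cspace_bounded.
Qed.

Lemma Cspace_norm_le (f : C) M : 0 <= M -> (forall t, `|f t| <= M) -> `|f| <= M.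
Proof.
move=> M0 fM.
apply: (sup_seminorm_le (D := [set: K]) (p := fun t (f : C) => `|f t|)) => //.
exact: Cspace_bounded.
Qed.

(** Point evaluations, as functionals to which weak nullness gets applied. *)
Definition Cspace_eval (t : K) (f : C) : KK^o := f t.

Fact Cspace_eval_linear t : linear (Cspace_eval t).
Proof. by []. Qed.

HB.instance Definition _ t :=
  GRing.isLinear.Build KK C KK^o *:%R (Cspace_eval t) (Cspace_eval_linear t).

Lemma Cspace_eval_continuous t : continuous (Cspace_eval t).
Proof.
move=> f A /nbhs_ballP[e e0 eA].
apply/nbhs_ballP; exists e => // g fg; apply: eA; move: fg; rewrite -!ball_normE /=.
by apply: le_lt_trans; exact: (Cspace_norm_ge (f - g)).
Qed.

Lemma Cspace_sumE (I : Type) (r : seq I) (b : I -> KK) (f : I -> C) t :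
  (\sum_(j <- r) b j *: f j) t = \sum_(j <- r) b j * f j t.
Proof.
rewrite -[LHS]/(Cspace_eval t _) linear_sum; apply: eq_bigr => j _.
by rewrite linearZ.
Qed.

(** The pointwise limit exists by completeness of the scalars; it is approximated uniformly, so it
    is continuous by splitting the error in three. *)
Lemma Cspace_cauchy_cvg (G : set_system C) : ProperFilter G -> cauchy G -> cvg G.
Proof.
move=> GG /cauchyP Gc.
have coord t : cvg ((fun f : C => f t) @ G).
  apply: scalar_cauchy_cvg; apply/cauchyP => e e0; have [g Gg] := Gc e e0.
  exists (g t); rewrite /fmap/=; apply: filterS Gg => h; rewrite -!ball_normE /=.
  by apply: le_lt_trans; exact: (Cspace_norm_ge (g - h)).
pose a t : KK := lim ((fun f : C => f t) @ G).
have near e : 0 < e -> exists2 g : C, G (ball g e) & forall t, `|a t - g t| <= e.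
  move=> e0; have [g Gg] := Gc (e / 2) (divr_gt0 e0 (ltr0Sn _ _)); exists g.
    by apply: filterS Gg; apply: le_ball; rewrite ler_pdivrMr// ler_peMr ?ler1n// ltW.
  move=> t; have /cvgrPdist_le/(_ _ (divr_gt0 e0 (ltr0Sn _ 1))) Ga := coord t.
  have [h []] := filter_ex (filterI Gg Ga); rewrite -ball_normE /= => gh ah.
  rewrite -(subrK (h t) (a t)) -addrA (le_trans (ler_normD _ _))// [leRHS]splitr lerD//.
  by rewrite distrC; apply: le_trans (ltW gh); exact: (Cspace_norm_ge (g - h)).
have ac : a \in @continuous_pred R k K.
  apply/asboolP => t; apply/cvgrPdist_le => e e0.
  have e3 : 0 < e / 3%:R by rewrite divr_gt0.
  have [g _ ag] := near _ e3.
  have /cvgrPdist_le/(_ _ e3) := Cspace_continuous (f := g) (x := t).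
  apply: filterS => u gu.
  have -> : a t - a u = (a t - g t) + (g t - g u) + (g u - a u).
    by rewrite !addrA !subrK.
  have -> : e = e / 3%:R + e / 3%:R + e / 3%:R.
    by rewrite -[LHS](@divfK _ 3%:R) ?pnatr_eq0// mulr_natr mulrS mulr2n addrA.
  rewrite (le_trans (ler_normD _ _))// lerD//; last by rewrite distrC.
  by rewrite (le_trans (ler_normD _ _))// lerD.
apply/cvg_ex; exists (MkCspace compactK ac); apply/cvgrPdist_le => e e0.
have [g Gg ag] := near _ (divr_gt0 e0 (ltr0Sn _ 1)); apply: filterS Gg => h.
rewrite -ball_normE /= => /ltW gh.
rewrite -(subrK g (MkCspace compactK ac)) -addrA (le_trans (ler_normD _ _))//.
rewrite [leRHS]splitr lerD//.
by apply: Cspace_norm_le => //; rewrite divr_ge0// ltW.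
Qed.

End Cspace_theory.

(** * Sums without cancellation *)

(** A grid of step 1/16 on [-1, 1], with rounding down. The error 1/16 is half of 1/8, so that the
    real and imaginary errors together stay within 1/8. *)
Lemma interval_net (R : realType) : exists s : seq R, forall x : R, `|x| <= 1 ->
  exists2 u, u \in s & `|x - u| <= 8^-1 / 2.
Proof.
exists [seq i%:R / 16%:R - 1 | i <- iota 0 33] => x; rewrite ler_norml => /andP[x1 x2].
pose i := Num.trunc (16%:R * (x + 1)).
have y0 : 0 <= 16%:R * (x + 1) by rewrite mulr_ge0// -lerBlDr sub0r.
have /andP[iy yi] := truncn_itv y0; rewrite -/i in iy yi.
exists (i%:R / 16%:R - 1).
  apply: (map_f (fun i : nat => i%:R / 16%:R - 1 : R)); rewrite mem_iota add0n leq0n /=.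
  rewrite -(ltr_nat R); apply: le_lt_trans iy _.
  apply: (@le_lt_trans _ _ (16%:R * (1 + 1))); first by rewrite ler_pM2l// lerD2r.
  by rewrite -[1 + 1]/(2%:R) -natrM ltr_nat.
have -> : x - (i%:R / 16%:R - 1) = (16%:R * (x + 1) - i%:R) / 16%:R by field.
rewrite normrM ger0_norm ?subr_ge0// (ger0_norm (_ : 0 <= 16%:R^-1)) ?invr_ge0//.
rewrite ler_pdivrMr// (_ : 8^-1 / 2 * 16%:R = 1); last by field.
by rewrite lerBlDr nat1r ltW.
Qed.

Lemma disc_net (R : realType) (k : scalar_kind) : exists s : seq (scalar_field R k),
  forall z, `|z| <= 1 -> exists2 u, u \in s & `|z - u| <= 8^-1.
Proof.
have [s sP] := interval_net R; case: k => /=.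
  exists s => z /sP[u us zu]; exists u => //; apply: le_trans zu _.
  by rewrite ler_pdivrMr// ler_peMr ?invr_ge0 ?ler1n.
exists [seq (a +i* b)%C | a <- s, b <- s] => z z1.
have Re1 : `|complex.Re z| <= 1 by rewrite -lecR; apply: le_trans (normc_ge_Re z) _.
have Im1 : `|complex.Im z| <= 1.
  rewrite -lecR; apply: le_trans z1; case: z {Re1} => a b.
  by rewrite normc_def /= lecR -sqrtr_sqr ler_wsqrtr// lerDr sqr_ge0.
have [a as_ za] := sP _ Re1; have [b bs zb] := sP _ Im1.
exists (a +i* b)%C; first by apply/allpairsP; exists (a, b).
have -> : 8^-1 = ((8^-1 : R)%:C)%C :> R[i]%C by rewrite fmorphV rmorph_nat.
by apply: normc_le_ReIm; rewrite raddfB.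
Qed.

(** The direction [u] is taken from a net, so its modulus is only close to 1. Zero lies in every
    cone. *)
Definition cone (KK : numFieldType) (u z : KK) := `|z - `|z| * u| <= `|z| / 8.

Lemma cone_cover (R : realType) (k : scalar_kind) :
  exists s : seq (scalar_field R k), forall z, exists2 u, u \in s & cone u z.
Proof.
have [s sP] := disc_net R k; exists s => z.
have [->|z0] := eqVneq z 0.
  have [|u us _] := sP 0; first by rewrite normr0.
  by exists u => //; rewrite /cone !normr0 !mul0r subrr normr0.
have nz : `|z| != 0 by rewrite normr_eq0.
have [|u us zu] := sP (z / `|z|).
  by rewrite normrM normfV normr_id divff.
exists u => //; rewrite /cone -[X in `|X - _|](divfK nz) mulrC -mulrBr.
by rewrite normrM normr_id ler_wpM2l.
Qed.

Lemma cone_norm (KK : numFieldType) (u z : KK) : z != 0 -> cone u z ->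
  7 / 8 <= `|u| <= 9 / 8.
Proof.
move=> z0 zu; have nz : 0 < `|z| by rewrite normr_gt0.
apply/andP; split.
  rewrite -(ler_pM2l nz) -[X in _ <= X * _]normr_id -normrM.
  have -> : `|z| * (7 / 8) = `|z| - `|z| / 8 by field.
  rewrite lerBlDr; apply: le_trans (lerD (lexx _) zu).
  by rewrite -{1}(subrKC (`|z| * u) z) ler_normD.
rewrite -(ler_pM2l nz) -[X in X * _ <= _]normr_id -normrM.
have -> : `|z| * (9 / 8) = `|z| + `|z| / 8 by field.
apply: le_trans (lerD (lexx _) zu); rewrite -{1}(subKr z (`|z| * u)).
exact: ler_normB.
Qed.

(* The radius 1/8 of the cones is chosen so that (7/8)^2 - (1/8 + 9/8 * 1/8) = 1/2. *)
Lemma cone_sum (KK : numFieldType) (I : eqType) (r : seq I) (u v : KK) (a z : I -> KK) :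
  (forall i, i \in r -> cone u (a i)) -> (forall i, i \in r -> cone v (z i)) ->
  \sum_(i <- r) `|a i| * `|z i| <= 2 * `|\sum_(i <- r) a i * z i|.
Proof.
move=> au zv; set S := \sum_(i <- r) `|a i| * `|z i|.
(* A nonzero product is needed to bound [u] and [v] through [cone_norm]; if there is none, both sums
   vanish. *)
have [/allP r0|/allPn[j jr]] := boolP (all (fun i => a i * z i == 0) r).
  by rewrite /S big_seq big1 ?mulr_ge0// => i /r0; rewrite -normrM => /eqP->; rewrite normr0.
rewrite mulf_eq0 negb_or => /andP[aj zj].
have /andP[u1 u2] := cone_norm aj (au _ jr); have /andP[v1 _] := cone_norm zj (zv _ jr).
have S0 : 0 <= S by apply: sumr_ge0 => i _; rewrite mulr_ge0.
have err : `|\sum_(i <- r) a i * z i - S * (u * v)| <= S * (17 / 64).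
  rewrite /S !mulr_suml -sumrB (le_trans (ler_norm_sum _ _ _))// big_seq [leRHS]big_seq.
  apply: ler_sum => i ir.
  have -> : a i * z i - `|a i| * `|z i| * (u * v) =
    (a i - `|a i| * u) * z i + `|a i| * u * (z i - `|z i| * v) by ring.
  apply: le_trans (ler_normD _ _) _; rewrite !normrM !normr_id.
  have -> : `|a i| * `|z i| * (17 / 64) =
    `|a i| / 8 * `|z i| + `|a i| * (9 / 8) * (`|z i| / 8) by field.
  apply: lerD; first by apply: ler_wpM2r => //; exact: au.
  by apply: ler_pM; rewrite ?mulr_ge0// ?ler_wpM2l//; exact: zv.
have low : S * (49 / 64) <= `|S * (u * v)|.
  rewrite !normrM (ger0_norm S0) ler_wpM2l//.
  have -> : 49 / 64 = (7 / 8) * (7 / 8) :> KK by field.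
  by rewrite ler_pM// divr_ge0.
have : S * (49 / 64) <= `|\sum_(i <- r) a i * z i| + S * (17 / 64).
  apply: le_trans low _; rewrite -(subKr (\sum_(i <- r) a i * z i) (S * (u * v))).
  by apply: le_trans (ler_normB _ _) _; rewrite lerD2l.
rewrite -lerBlDr; have -> : S * (49 / 64) - S * (17 / 64) = S / 2 by field.
by rewrite ler_pdivrMr// mulrC.
Qed.

Section fset_sums.
Variables (KK : numFieldType) (g : nat -> KK).

Lemma sum_fset_widen (A B : {fset nat}) : (A `<=` B)%fset ->
  \sum_(j <- A) g j = \sum_(j <- B) if j \in A then g j else 0.
Proof.
move=> /fsubsetP AB; rewrite -big_mkcond -[RHS]big_filter; apply: perm_big.
apply: uniq_perm => [||j]; rewrite ?filter_uniq ?fset_uniq//.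
by rewrite mem_filter; case jA: (j \in A) => //=; rewrite AB.
Qed.

Lemma sum_bigfcup_le (Gs : seq {fset nat}) (m : KK) : (forall j, 0 <= g j) ->
  (forall G, G \in Gs -> \sum_(j <- G) g j <= m) ->
  \sum_(j <- (\bigcup_(G <- Gs) G)%fset) g j <= (size Gs)%:R * m.
Proof.
move=> g0; elim: Gs => [|G Gs IH] mG.
  by rewrite big_nil big_seq_fset0 mul0r.
rewrite big_cons -natr1 mulrDl mul1r addrC.
set U := (\bigcup_(G <- Gs) G)%fset.
apply: (@le_trans _ _ (\sum_(j <- G) g j + \sum_(j <- U) g j)); last first.
  apply: lerD; first by apply: mG; rewrite inE eqxx.
  by apply: IH => H HGs; apply: mG; rewrite inE HGs orbT.
rewrite (sum_fset_widen (fsubsetUl G U)) (sum_fset_widen (fsubsetUr G U)) -big_split/=.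
rewrite big_seq [leRHS]big_seq; apply: ler_sum => j; rewrite inE.
by case: (j \in G); case: (j \in U) => //= _; rewrite ?addr0 ?add0r// lerDl.
Qed.

End fset_sums.

(** * Norm estimates *)

Lemma Xspace_sum_coord (R : realType) (k : scalar_kind) alpha xi
    (P : {fset nat}) (b : nat -> scalar_field R k) i :
  (\sum_(j <- P) b j *: Xspace_basis R k alpha xi j) i = if i \in P then b i else 0.
Proof.
pose ev (x : Xspace R k alpha xi) : scalar_field R k := x i.
rewrite -[LHS]/(ev _) (big_morph ev (op1 := +%R) (id1 := 0))//.
rewrite (eq_bigr (fun j => if i == j then b j else 0)); last first.
  by move=> j _; rewrite /ev /= -[LHS]/(b j * (i == j)%:R); case: eqP; rewrite ?mulr1 ?mulr0.
rewrite -big_mkcond /= -big_filter.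
rewrite (perm_big (if i \in P then [:: i] else [::])); last first.
  apply: uniq_perm; rewrite ?filter_uniq ?fset_uniq//; first by case: ifP.
  move=> j; rewrite mem_filter; have [<-|ij] := eqVneq i j.
    by case: (i \in P); rewrite ?inE ?eqxx.
  by case: (i \in P); rewrite ?inE // eq_sym (negbTE ij).
by case: (i \in P); rewrite ?big_seq1 ?big_nil.
Qed.

Lemma increasing_enumeration M : unbounded M ->
  exists2 phi : nat -> nat, {homo phi : m n / (m < n)%N} & forall n, M (phi n).
Proof.
move=> uM; have /choice[g gP] n : exists m, M m /\ (n < m)%N.
  by have [m ? ?] := uM n.+1; exists m.
exists (fun n => iter n.+1 g 0%N); last by move=> n; have [] := gP (iter n g 0%N).
apply: homo_ltn; first exact: ltn_trans.
by move=> n; have [] := gP (iter n.+1 g 0%N).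
Qed.

(** Passes from sums along a subsequence to sums over a finite subset of its range. The same [P] and
    [b] serve every space, hence both sequences under comparison. *)
Lemma sum_reindex_fset (KK : numFieldType) (phi : nat -> nat) n (c : nat -> KK) :
  {homo phi : m n / (m < n)%N} ->
  exists (P : {fset nat}) (b : nat -> KK), [set` P] `<=` range phi /\
  forall (V : normedModType KK) (x : nat -> V),
    \sum_(i < n) c i *: (x \o phi) i = \sum_(j <- P) b j *: x j.
Proof.
move=> phi_lt; have phi_inj : injective phi.
  by move=> i j ij; case: (ltngtP i j) => // /phi_lt; rewrite ij ltnn.
exists [fset j in map phi (iota 0 n)]%fset.
exists (fun j => \sum_(i < n | phi i == j) c i).
split=> [j|V x].
  by rewrite /= in_fset => /mapP[i _ ->]; exists i.
rewrite (perm_big (map phi (iota 0 n))); last first.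
  apply: uniq_perm; rewrite ?fset_uniq ?map_inj_uniq ?iota_uniq// => j.
  by rewrite in_fset.
rewrite big_map -(big_mkord xpredT (fun i => c i *: (x \o phi) i)) /index_iota subn0.
apply: eq_big_seq => i; rewrite mem_iota => iN /=; congr (_ *: _).
by rewrite (big_pred1 (Ordinal (iN : (i < n)%N)))// => j /=; rewrite (inj_eq phi_inj).
Qed.

Section gap_sequences.
Variables (alpha : fundamental_system) (R : realType) (k : scalar_kind).
Variables (K : topologicalType) (compactK : compact [set: K]).
Local Notation KK := (scalar_field R k).
Variable f : nat -> Cspace R k compactK.
Hypothesis f_normalized : forall n : nat, `|f n| = 1.
Hypothesis f_weakly_null : weakly_null f.
Variable e : KK.
Hypothesis e0 : 0 < e.
Hypothesis f_gap : forall (t : K) (n : nat), f n t = 0 \/ e <= `|f n t|.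

Let A (t : K) : set nat := [set n | f n t != 0].
Let F (B : {fset nat}) := exists t, [set` B] `<=` A t.

Let f_le1 n t : `|f n t| <= 1.
Proof. by rewrite -(f_normalized n) Cspace_norm_ge. Qed.

Let f_ge n t : A t n -> e <= `|f n t|.
Proof. by rewrite /A /=; case: (f_gap t n) => [->|//]; rewrite eqxx. Qed.

Let F_hereditary : hereditary F.
Proof. by move=> B D /fsubsetP DB [t Bt]; exists t => i /DB; exact: Bt. Qed.

Let F_set1 i : F [fset i]%fset.
Proof.
apply: contrapT => nF; have : `|f i| = 0; last by rewrite f_normalized => /eqP; rewrite oner_eq0.
apply/eqP; rewrite eq_le normr_ge0 andbT; apply: Cspace_norm_le => // t.
rewrite normr_le0; apply: contrapT => /negP fit; apply: nF; exists t => j.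
by rewrite /= inE => /eqP ->.
Qed.

(* The sets {t | f_n(t) = 0} are open by the gap, so a cluster point p of points t_n
   with Z cap [0, n) in A t_n has Z in A p, contradicting f_n(p) -> 0. *)
Let F_compact Z : unbounded Z ->
  ~ (forall s : {fset nat}, [set` s] `<=` Z -> F s).
Proof.
move=> uZ FZ.
have /choice[t tP] n : exists t, forall i, Z i -> (i < n)%N -> A t i.
  have [B BP] := truncation Z n.
  have [|t Bt] := FZ B; first by move=> i /BP[].
  by exists t => i Zi iN; apply: Bt; apply/BP.
have [|p [_ pcl]] := compactK (F := t @ \oo) _; first exact: filterT.
have Zp m : Z m -> A p m.
  move=> Zm; apply/negP => /eqP fp0.
  have near0 : nbhs p [set u | `|f m u| < e].
    have /cvgrPdist_lt/(_ _ e0) := Cspace_continuous (f := f m) (x := p).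
    by apply: filterS => u /=; rewrite fp0 sub0r normrN.
  have nearZ : (t @ \oo) [set u | A u m].
    by exists m.+1 => // n /= mn; apply: tP.
  have [u [Aum /=]] := pcl _ _ nearZ near0.
  by move=> /(le_lt_trans (f_ge Aum)); rewrite ltxx.
have /cvgrPdist_lt/(_ _ e0) [N _ fN] :=
  f_weakly_null (phi := @Cspace_eval R k K compactK p) (@Cspace_eval_continuous R k K compactK p).
have [m Zm Nm] := uZ N; have := fN m Nm.
by rewrite /= sub0r normrN => /(le_lt_trans (f_ge (Zp _ Zm))); rewrite ltxx.
Qed.

(** A member of [S xi] inside [M] is one point plus a member of [F], and sums over members of [F]
    cost a factor [C1]; hence the constant 2 [C1]. Conversely, the terms that do not vanish at t are
    indexed by a member of [F], covered by at most [k'] members of [S xi]. *)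
Lemma subsequence_norm_equivalence : exists (xi : omega1) (M : set nat) (C D : KK),
  [/\ unbounded M, 0 <= C, 0 <= D,
  forall (P : {fset nat}) (b : nat -> KK), [set` P] `<=` M ->
    `|\sum_(j <- P) b j *: Xspace_basis R k alpha xi j| <=
    C * `|\sum_(j <- P) b j *: f j|
  & forall (P : {fset nat}) (b : nat -> KK), [set` P] `<=` M ->
    `|\sum_(j <- P) b j *: f j| <=
    D * `|\sum_(j <- P) b j *: Xspace_basis R k alpha xi j|].
Proof.
have [s sP] := cone_cover R k.
pose G v t : set nat := [set n | A t n /\ cone v (f n t)].
(* One infinite set serves all cones of the net simultaneously. *)
have [|v X _|n|M0 [_ uM0 M0P]] := @dense_all _ (fun v (M : set nat) =>
  forall t (P B : {fset nat}), [set` P] `<=` M -> (B `<=` P)%fset ->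
    [set` B] `<=` G v t ->
    exists t', A t' `&` [set` P] = [set` B] /\ [set` B] `<=` G v t') setT s.
- by move=> v X Y YX XP t P B PY; apply: XP; exact: subset_trans YX.
- by apply: monochromatic_subsets => [Z uZ AZ|t i []//]; exact: F_compact AZ.
- by exists n.
have [xi [k' [M [MM0 uM FM SM]]]] := schreier_approximation alpha F_hereditary
  F_compact F_set1 uM0.
(* One term for each pair of cones, for the coefficients and for the values; 2 comes from [cone_sum]
   and 1/e from the gap. *)
pose C1 : KK := (size [seq (u, v) | u <- s, v <- s])%:R * (2 / e).
have C10 : 0 <= C1 by rewrite mulr_ge0// divr_ge0// ltW.
exists xi, M, (2%:R * C1), k'%:R; split=> //; first exact: mulr_ge0.
- move=> P b PM; set w := \sum_(j <- P) b j *: f j.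
  have FP (B : {fset nat}) : (B `<=` P)%fset -> F B -> \sum_(j <- B) `|b j| <= C1 * `|w|.
    move=> BP [t Bt].
    pose Buv (uv : KK * KK) := [fset j in B | cone uv.1 (b j) && cone uv.2 (f j t)]%fset.
    have -> : B = (\bigcup_(H <- [seq Buv uv | uv <- [seq (u, v) | u <- s, v <- s]]) H)%fset.
      apply/fsetP => j; apply/idP/mem_seq_bigfcup => [jB|[_ /mapP[uv _ ->]]]; last first.
        by rewrite !inE/= => /andP[].
      have [u us bu] := sP (b j); have [v vs fv] := sP (f j t).
      exists (Buv (u, v)); last by rewrite !inE/= jB bu.
      by apply: map_f; apply/allpairsP; exists (u, v).
    rewrite /C1 -mulrA -(size_map Buv); apply: sum_bigfcup_le => // _ /mapP[[u v] + ->].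
    move=> /allpairsP[[u' v'] /= [_ v's [_ vE]]]; have {v's vE} vs : v \in s by rewrite vE.
    have BuvB : (Buv (u, v) `<=` P)%fset.
      by apply: fsubset_trans BP; apply/fsubsetP => j; rewrite !inE/= => /andP[].
    have [|t' [t'P t'G]] := M0P v vs t P (Buv (u, v)) (subset_trans PM MM0) BuvB.
      by move=> j /=; rewrite !inE/= => /andP[jB /andP[_ fv]]; split=> //; exact: Bt.
    rewrite mulrAC ler_pdivlMr// mulr_suml.
    apply: le_trans (_ : 2 * `|w t'| <= _); last first.
      by rewrite ler_pM2l// Cspace_norm_ge.
    (* The support of [t'] meets [P] exactly in this part of [B], so no other term survives at
       [t']. *)
    have -> : w t' = \sum_(j <- Buv (u, v)) b j * f j t'.
      rewrite /w Cspace_sumE (sum_fset_widen _ BuvB) big_seq [RHS]big_seq.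
      apply: eq_bigr => j jP; case: ifPn => // jB.
      have [->|fj] := eqVneq (f j t') 0; first by rewrite mulr0.
      case/negP: jB; have : (A t' `&` [set` P]) j by [].
      by rewrite t'P.
    apply: le_trans (cone_sum (u := u) (v := v) _ _).
    + rewrite big_seq [leRHS]big_seq; apply: ler_sum => j jB.
      by rewrite ler_wpM2l// f_ge//; have [] := t'G _ jB.
    + by move=> j; rewrite !inE/= => /andP[_ /andP[]].
    + by move=> j /t'G[].
  apply: Xspace_norm_le => [|H SH]; first by rewrite mulr_ge0// mulr_ge0.
  pose H' := (H `&` P)%fset.
  have -> : \sum_(i <- H) `|(\sum_(j <- P) b j *: Xspace_basis R k alpha xi j) i| =
      \sum_(i <- H') `|b i|.
    rewrite (sum_fset_widen _ (fsubsetIl H P)) big_seq [RHS]big_seq; apply: eq_bigr => i iH.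
    by rewrite Xspace_sum_coord inE iH /=; case: ifP => //; rewrite normr0.
  have H'P : (H' `<=` P)%fset by exact: fsubsetIr.
  have [->|H'0] := eqVneq H' fset0; first by rewrite big_seq_fset0 mulr_ge0// mulr_ge0.
  have SH' : F (H' `\ fsmin H')%fset.
    apply: SM; last by apply: hereditary_schreier SH; exact: fsubsetIl.
    by move=> i /(fsubsetP H'P)/PM.
  pose Hs := [:: [fset fsmin H'] ; H' `\ fsmin H']%fset.
  have -> : H' = (\bigcup_(D <- Hs) D)%fset.
    by rewrite big_cons big_seq1 fsetD1K// fsmin_in.
  rewrite -mulrA; apply: (@sum_bigfcup_le _ _ Hs) => // D.
  rewrite !inE => /orP[/eqP ->|/eqP ->]; apply: FP => //.
    by rewrite fsub1set; apply/(fsubsetP H'P)/fsmin_in.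
  by apply: fsubset_trans H'P; exact: fsubD1set.
- move=> P b PM; set w := \sum_(j <- P) b j *: Xspace_basis R k alpha xi j.
  apply: Cspace_norm_le => [|t]; first by rewrite mulr_ge0.
  pose B := [fset j in P | f j t != 0]%fset.
  have BP : (B `<=` P)%fset by apply/fsubsetP => j; rewrite !inE/= => /andP[].
  apply: (@le_trans _ _ (\sum_(j <- B) `|w j|)).
    rewrite Cspace_sumE (le_trans (ler_norm_sum _ _ _))// (sum_fset_widen _ BP).
    rewrite big_seq [leRHS]big_seq; apply: ler_sum => j jP.
    rewrite !inE/= jP /= normrM Xspace_sum_coord jP.
    by case: eqP => [->|_] /=; rewrite ?normr0 ?mulr0// ler_piMr ?f_le1.
  have [||Gs [-> nG SG]] := FM B.
  + by move=> i /(fsubsetP BP)/PM.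
  + by exists t => i; rewrite /= !inE/= => /andP[].
  apply: le_trans (_ : (size Gs)%:R * `|w| <= _); last by rewrite ler_wpM2r// ler_nat.
  by apply: sum_bigfcup_le => // D /SG; exact: Xspace_norm_ge.
Qed.

End gap_sequences.

Theorem theorem3p10 (alpha : fundamental_system)
    (R : realType) (k : scalar_kind)
    (K : topologicalType) (compactK : compact [set: K])
    (hausdorffK : hausdorff_space K)
    (f : nat -> Cspace R k compactK)
    (f_normalized : forall n : nat, `|f n| = 1)
    (f_weakly_null : weakly_null f)
    (f_gap : exists2 e : scalar_field R k, 0 < e &
       forall (t : K) (n : nat), f n t = 0 \/ e <= `|f n t|) :
  exists (xi : omega1) (phi psi : nat -> nat),
    [/\ {homo phi : m n / (m < n)%N},
        {homo psi : m n / (m < n)%N}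
      & equivalent (f \o phi) (Xspace_basis R k alpha xi \o psi)].
Proof.
have [e e0 gap] := f_gap.
have [xi [M [C [D [uM C0 D0 lower upper]]]]] :=
  subsequence_norm_equivalence alpha f_normalized f_weakly_null e0 gap.
have [phi phi_lt phiM] := increasing_enumeration uM.
exists xi, phi, phi; split=> //; apply: (equivalent_of_norms (C := C) (D := D)) => //.
- exact: Cspace_cauchy_cvg.
- exact: Xspace_cauchy_cvg.
- move=> n c; have [P [b [Pphi PE]]] := sum_reindex_fset n c phi_lt.
  by rewrite !PE; apply: lower => i /Pphi[j _ <-].
- move=> n c; have [P [b [Pphi PE]]] := sum_reindex_fset n c phi_lt.
  by rewrite !PE; apply: upper => i /Pphi[j _ <-].
Qed.
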